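(* Let $a,b>0$ and let $L=\{L_t\}_{t\ge 0}$ be the inverse of the gamma subordinator $H$ with Laplace exponent $\Phi(\lambda)=a\ln(1+\lambda/b)$. Let $q\in[1,\infty)$ and $t>0$. (i) The moments of $L$ are given by $$\mathbf{E}_0[L_t^q]=\frac{\Gamma(q+1)}{a^q}\sum_{n=0}^\infty e^{-bt}\,\mu(bt,q-1,n)=\frac{b\,\Gamma(q+1)}{a^q}\int_0^t e^{-bs}\,\mu(bs,q-1,-1)\,ds .$$ (ii) Moreover, as $t\to\infty$, $$\mathbf{E}_0[L_t^q]\sim\left(\frac{b\,t}{a}\right)^q .$$
   Context: Fix $a,b>0$. The gamma subordinator $H=\{H_t\}_{t\ge0}$ is the subordinator (Lévy process with non-decreasing paths) started at $H_0=0$ with $\mathbf{E}_0[e^{-\lambda H_t}]=e^{-t\Phi(\lambda)}$, $\lambda\ge 0$, where $\Phi(\lambda)=a\ln(1+\lambda/b)$; $\mathbf{E}_0$ is expectation under the law $\mathbf{P}_0$ of the process started at $0$. For $t>0$ the law of $H_t$ has density $h(t,x)=\frac{b^{at}}{\Gamma(at)}x^{at-1}e^{-bx}$ for $x>0$ (and $0$ for $x\le0$). The inverse process is $L_t=\inf\{s>0: H_s\notin(0,t)\}$, $t>0$, with $L_0=0$; one has $\mathbf{P}_0(H_t<s)=\mathbf{P}_0(L_s>t)$ for $s,t>0$. For $\alpha\in\mathbb{R}$, $\beta>-1$, $x>0$, $$\mu(x,\beta,\alpha)=\int_0^\infty\frac{x^{\alpha+y}\,y^\beta}{\Gamma(\beta+1)\,\Gamma(\alpha+y+1)}\,dy$$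 (with $1/\Gamma$ the entire reciprocal gamma function). The notation $f\sim g$ means that $f(z)/g(z)\to c$ as $z\to\infty$, where $c$ is a positive constant. *)

(* Defs.v *)
(* World: MathComp-Analysis. *)
From HB Require Import structures.
From mathcomp Require Import all_boot all_order all_algebra.
From mathcomp Require Import all_classical all_reals all_analysis.
Import Order.TTheory GRing.Theory Num.Theory.
Import numFieldNormedType.Exports.

Set Implicit Arguments.
Unset Strict Implicit.
Unset Printing Implicit Defensive.

Local Open Scope classical_set_scope.
Local Open Scope ring_scope.

(* Euler's integral; meaningful for 0 < x only. *)
Definition Gamma (R : realType) (x : R) : R :=
  \int[lebesgue_measure]_(u in `]0, +oo[) (u `^ (x - 1) * expR (- u)).

(* The restriction to the real line of the entire function 1/Gamma. For x <= 0
   it is continued by 1/Gamma(x) = x (x + 1) ... (x + m - 1) / Gamma(x + m),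
   where m is the least natural number with 0 < x + m; in particular it
   vanishes at 0, -1, -2, ... *)
Definition rGamma (R : realType) (x : R) : R :=
  if 0 < x then (Gamma x)^-1
  else let m := (Num.truncn (- x)).+1 in
       (\prod_(i < m) (x + i%:R)) / Gamma (x + m%:R).

(* mu(x, beta, alpha), for 0 < x and -1 < beta. Taking values in \bar R, it has
   no default value standing for a divergent integral. *)
Definition mu (R : realType) (x beta alpha : R) : \bar R :=
  (\int[lebesgue_measure]_(y in `]0%R, +oo[)
     (x `^ (alpha + y) * y `^ beta *
      (rGamma (beta + 1) * rGamma (alpha + y + 1)))%:E)%E.

(* The choice B i = setT shows that the product rule for subfamilies is
   included. *)
Definition independent_RVs (d : measure_display) (T : measurableType d)
    (R : realType) (P : probability T R) (n : nat) (X : 'I_n -> T -> R) : Prop :=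
  forall B : 'I_n -> set R, (forall i, measurable (B i)) ->
    P [set w | forall i, B i (X i w)] = (\prod_(i < n) P (X i @^-1` B i))%E.

Definition cadlag (R : realType) (f : R -> R) : Prop :=
  (forall t, 0 <= t -> f s @[s --> t^'+] --> f t) /\
  (forall t, 0 < t -> cvg (f s @[s --> t^'-])).

(* The time set of all processes is [0, +oo[: H t is irrelevant for t < 0. *)
Record levy_process (d : measure_display) (T : measurableType d)
    (R : realType) (P : probability T R) (H : R -> {RV P >-> R}) : Prop :=
  LevyProcess {
    levy_start : {ae P, forall w, H 0 w = 0} ;
    levy_cadlag : {ae P, forall w, cadlag (fun t => H t w)} ;
    levy_stationary : forall s t : R, 0 <= s -> 0 <= t ->
      forall B : set R, measurable B ->
        P [set w | B (H (s + t) w - H s w)] = P (H t @^-1` B) ;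
    levy_independent : forall (n : nat) (t : nat -> R),
      0 <= t 0%N -> {homo t : i j / (i <= j)%N >-> i <= j} ->
        independent_RVs P (fun (i : 'I_n) w => H (t i.+1) w - H (t i) w)
  }.

Definition subordinator (d : measure_display) (T : measurableType d)
    (R : realType) (P : probability T R) (H : R -> {RV P >-> R}) : Prop :=
  levy_process H /\
  {ae P, forall w, forall s t : R, 0 <= s -> s <= t -> H s w <= H t w}.

Definition gamma_exponent (R : realType) (a b lambda : R) : R :=
  a * ln (1 + lambda / b).

Definition gamma_subordinator (d : measure_display) (T : measurableType d)
    (R : realType) (P : probability T R) (a b : R) (H : R -> {RV P >-> R}) :
    Prop :=
  subordinator H /\
  forall t lambda : R, 0 <= t -> 0 <= lambda ->
    'E_P[fun w => expR (- lambda * H t w)]%E =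
    (expR (- t * gamma_exponent a b lambda))%:E.

(* The infimum is taken in \bar R, so that it is +oo if H never leaves ]0, t[
   (a null event for the gamma subordinator). *)
Definition inverse_process (d : measure_display) (T : measurableType d)
    (R : realType) (P : probability T R) (H : R -> {RV P >-> R})
    (t : R) (w : T) : \bar R :=
  ereal_inf [set s%:E | s in [set s : R | 0 < s /\ ~ (0 < H s w < t)]].

(* The convention L_0 = 0 is an instance of the formula. *)
Lemma inverse_process0 (d : measure_display) (T : measurableType d)
    (R : realType) (P : probability T R) (H : R -> {RV P >-> R}) (w : T) :
  inverse_process H 0 w = 0%E.
Proof.
apply/eqP; rewrite eq_le; apply/andP; split; last first.
  by apply: le_ereal_inf_tmp => _ [s [s0 _] <-]; rewrite lee_fin ltW.
apply/lee_addgt0Pr => e e0; rewrite add0e; apply: ereal_inf_lbound.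
by exists e => //; split => // /andP[h0 h1]; have := lt_trans h0 h1; rewrite ltxx.
Qed.

(* f ~ g at +oo in the weak sense: the quotient tends to some positive
   constant, not necessarily 1. *)
Definition sim_pinfty (R : realType) (f : R -> \bar R) (g : R -> R) : Prop :=
  exists2 c : R, 0 < c & (f z * ((g z)^-1)%:E)%E @[z --> +oo] --> c%:E.

(* Main.v *)
(* For a gamma subordinator, H_s has the Gamma(a s, b) law: the Laplace
   transform gives all moments of exp(-b H_s), and these determine a law on
   [0, 1] (Bernstein polynomials). Almost every path is right-continuous,
   nondecreasing and positive on ]0, +oo[, so s < L_t iff H_s < t, whence
     E[L_t^q] = int_0^oo q s^(q-1) P(H_s < t) ds
              = (q / a^q) int_0^oo y^(q-1) I(y, b t) dy,
   where I(y, z) = (1/Gamma(y)) int_0^z u^(y-1) e^(-u) du. Both formulas of (i)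
   follow by Tonelli, the first from I(y, z) = sum_n e^(-z) z^(n+y) /
   Gamma(n+y+1). For (ii), put y = z v with z = b t: a Chernoff bound for the
   Gamma law gives I(z v, z) -> 1 for v < 1 and I(z v, z) -> 0 for v > 1, with
   I(z v, z) <= e 2^(-v) for z >= 1, so dominated convergence shows that
   E[L_t^q] / (b t / a)^q -> q int_0^1 v^(q-1) dv = 1. *)
Require Import Defs.
From HB Require Import structures.
From mathcomp Require Import all_boot all_order all_algebra.
From mathcomp Require Import all_classical all_reals all_analysis.
From mathcomp Require Import measurable_realfun ring lra.
Import Order.TTheory GRing.Theory Num.Theory.
Import numFieldNormedType.Exports.

Set Implicit Arguments.
Unset Strict Implicit.
Unset Printing Implicit Defensive.

Local Open Scope classical_set_scope.
Local Open Scope ring_scope.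

(** * Lebesgue integrals on the half-line *)

Local Notation mpushforward :=
  measure_function_pushforward__canonical__measure_function_Measure.

Lemma lebesgue_measure_preimage_mul (R : realType) (c : R) (A : set R) :
  0 < c -> measurable A ->
  lebesgue_measure A =
  (c%:E * lebesgue_measure ((fun x : R => (c * x)%R) @^-1` A))%E.
Proof.
move=> c0 mA.
have mc : measurable_fun setT (fun x : measurableTypeR R => c * x : measurableTypeR R).
  exact: mulrl_measurable.
rewrite -[RHS]/(mscale (NngNum (ltW c0)) (mpushforward lebesgue_measure mc) A).
apply: lebesgue_measure_unique => //= _ [[x y]] _ <-.
rewrite /mscale /= /pushforward /=.
rewrite (_ : (_ @^-1` _) = [set` `]x / c, y / c]]); last first.
  apply/seteqP; split => z /=; rewrite !in_itv/= ltr_pdivrMr// ler_pdivlMr//.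
    by rewrite ![_ * z]mulrC.
  by rewrite ![_ * z]mulrC.
rewrite !lebesgue_measure_itv /= !lte_fin ltr_pM2r ?invr_gt0//.
case: ifP => _; last by rewrite mule0.
by rewrite -!EFinD -EFinM -mulNr -mulrDl mulrCA divff ?gt_eqF// mulr1.
Qed.

Lemma ge0_integral_scale (R : realType) (c : R) (D : set R) (f : R -> \bar R) :
  0 < c -> measurable D -> measurable_fun D f ->
  (forall x, D x -> (0 <= f x)%E) ->
  (\int[lebesgue_measure]_(x in D) f x = c%:E *
    \int[lebesgue_measure]_(x in (fun x : R => (c * x)%R) @^-1` D) f (c * x)%R)%E.
Proof.
move=> c0 mD mf f0.
have mc : measurable_fun setT (fun x : measurableTypeR R => c * x : measurableTypeR R).
  exact: mulrl_measurable.
rewrite (eq_measure_integral (mscale (NngNum (ltW c0))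
  (mpushforward lebesgue_measure mc))); last first.
  by move=> A mA _; exact: lebesgue_measure_preimage_mul.
rewrite ge0_integral_mscale//= ge0_integral_pushforward//.
by move=> x; rewrite inE; exact: f0.
Qed.

Lemma ge0_integral_derive_itvoo (R : realType) (F f : R -> R) (F0 z : R) :
  0 < z ->
  (forall x : R, 0 < x -> is_derive x 1 F (f x)) ->
  (forall x : R, 0 < x -> 0 <= f x) ->
  (forall x : R, 0 < x -> {for x, continuous f}) ->
  F x @[x --> 0^'+] --> F0 ->
  (\int[lebesgue_measure]_(x in `]0%R, z[) (f x)%:E = (F z - F0)%:E)%E.
Proof.
move=> z0 dF f0 cf F00.
pose e (n : nat) : R := z / n.+2%:R.
have e0 n : 0 < e n by rewrite divr_gt0.
have ez n : e n < z by rewrite ltr_pdivrMr// ltr_pMr// ltr1n.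
have ecvg : e n @[n --> \oo] --> (0 : R).
  rewrite -(mulr0 z); apply: cvgM; first exact: cvg_cst.
  have -> : (fun n : nat => (n.+2%:R)^-1 : R) = [sequence @harmonic R n.+1]_n.
    by [].
  by rewrite cvg_shiftS; exact: cvg_harmonic.
have cF (x : R) : 0 < x -> {for x, continuous F}.
  move=> x0; apply/differentiable_continuous/derivable1_diffP.
  by case: (dF _ x0).
pose A n : set R := `]e n, z[%classic.
have AU : \bigcup_n A n = `]0, z[%classic.
  apply/seteqP; split => x /=.
    move=> [n _]; rewrite /A/= !in_itv/= => /andP[ex ->].
    by rewrite (lt_trans (e0 n)).
  rewrite in_itv/= => /andP[x0 xz].
  have := ecvg => /cvgrPdist_lt /(_ x x0) [n _ /(_ n (leqnn n))].
  rewrite sub0r normrN gtr0_norm// => enx; exists n => //.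
  by rewrite /A /= in_itv/= enx.
have eS n : e n.+1 <= e n.
  by rewrite ler_pM2l// lef_pV2 ?posrE// ler_nat.
have mfA n : measurable_fun (A n) f.
  apply: open_continuous_measurable_fun; first exact: interval_open.
  by move=> x; rewrite inE /A /= in_itv/= => /andP[/(lt_trans (e0 n))] /cf.
have IA n : (\int[lebesgue_measure]_(x in A n) (f x)%:E = (F z - F (e n))%:E)%E.
  rewrite /A -(@integral_itv_bndoo R _ _ _ true false); last first.
    by apply/measurable_EFinP; exact: (mfA n).
  rewrite EFinB; apply: continuous_FTC2 => //.
  - apply: continuous_in_subspaceT => x; rewrite inE/= in_itv/= => /andP[ex _].
    by apply: cf; exact: lt_le_trans ex.
  - split.
    + move=> x; rewrite in_itv/= => /andP[ex _].
      by case: (dF x (lt_trans (e0 n) ex)).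
    + exact: cvg_at_right_filter (cF _ (e0 n)).
    + exact: cvg_at_left_filter (cF _ z0).
  - move=> x; rewrite in_itv/= => /andP[ex _].
    by have := dF x (lt_trans (e0 n) ex) => H; rewrite derive1E derive_val.
have H : (\int[lebesgue_measure]_(x in A n) (f x)%:E)%E @[n --> \oo] -->
    (\int[lebesgue_measure]_(x in `]0%R, z[) (f x)%:E)%E.
  rewrite -AU; apply: ge0_nondecreasing_set_cvg_integral.
  - apply/nondecreasing_seqP => n; apply/subsetPset => x; rewrite /A /= !in_itv/=.
    by move=> /andP[ex ->]; rewrite (le_lt_trans (eS n)).
  - by move=> n; exact: measurable_itv.
  - by move=> n; apply/measurable_EFinP; exact: (mfA n).
  - move=> n x; rewrite /A /= in_itv/= => /andP[ex _].
    by rewrite lee_fin f0// (lt_trans (e0 n)).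
apply: (cvg_unique _ H) => //=.
under eq_fun do rewrite IA.
apply: cvg_EFin; first exact: nearW.
apply: cvgB; first exact: cvg_cst.
by move/cvg_at_rightP: F00; apply; split.
Qed.

(** * The gamma integral *)

Definition lower_gamma (R : realType) (y z : R) : \bar R :=
  (\int[lebesgue_measure]_(u in `]0%R, z[) (u `^ (y - 1) * expR (- u))%:E)%E.

Lemma continuous_powR (R : realType) (a x : R) :
  0 < x -> {for x, continuous (fun u : R => u `^ a)}.
Proof.
move=> x0; apply/differentiable_continuous/derivable1_diffP.
by have [] := @is_derive1_powR R a x x0.
Qed.

Lemma measurable_powR_in (R : realType) (y : R) (D : set R) :
  measurable_fun D (fun u : R => u `^ y).
Proof. exact: measurable_funS measurableT (@subsetT _ _) (measurable_powR _). Qed.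

Lemma measurable_powR_expRNM (R : realType) (y c : R) (D : set R) :
  measurable_fun D (fun u : R => u `^ y * expR (- (c * u))).
Proof.
apply: measurable_funS measurableT (@subsetT _ _) _.
apply: measurable_funM; first exact: measurable_powR.
apply: measurableT_comp; first exact: measurable_expR.
by apply: measurableT_comp; [exact: oppr_measurable|exact: mulrl_measurable].
Qed.

Lemma measurable_powR_expRN (R : realType) (y : R) (D : set R) :
  measurable_fun D (fun u : R => u `^ y * expR (- u)).
Proof.
have -> : (fun u : R => u `^ y * expR (- u)) =
    (fun u => u `^ y * expR (- (1 * u))) by apply/funext => u; rewrite mul1r.
exact: measurable_powR_expRNM.
Qed.

Lemma integral_powRB1 (R : realType) (y z : R) : 0 < y -> 0 < z ->
  (\int[lebesgue_measure]_(u in `]0%R, z[) (y * u `^ (y - 1))%:E =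
   (z `^ y)%:E)%E.
Proof.
move=> y0 z0.
rewrite (@ge0_integral_derive_itvoo R (fun u => u `^ y)
  (fun u => y * u `^ (y - 1)) 0 z z0).
- by rewrite subr0.
- by move=> x x0; rewrite mulr_ge0 ?powR_ge0// ltW.
- move=> x x0; apply: continuousM; first exact: cvg_cst.
  exact: continuous_powR.
- exact: powR_cvg0.
Qed.

(* The derivative f1 of u^y (1 - e^(-u)) is nonnegative, unlike that of
   u^y e^(-u), so that it can be integrated without any integrability. *)
Lemma lower_gammaS (R : realType) (y z : R) : 0 < y -> 0 < z ->
  (y%:E * lower_gamma y z =
   (z `^ y * expR (- z))%:E + lower_gamma (y + 1) z)%E.
Proof.
move=> y0 z0.
have mD : measurable (`]0, z[ : set R) by [].
have me (p : R) : measurable_fun `]0, z[ (fun u : R => u `^ p * expR (- u)).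
  exact: measurable_powR_expRN.
pose f1 (u : R) : R := y * u `^ (y - 1) * (1 - expR (- u)) + u `^ y * expR (- u).
have f1_ge0 (x : R) : 0 < x -> 0 <= y * x `^ (y - 1) * (1 - expR (- x)).
  move=> x0; rewrite mulr_ge0 ?mulr_ge0 ?powR_ge0 ?subr_ge0 ?(ltW y0)//.
  by rewrite expR_le1 oppr_le0 ltW.
have If1 : (\int[lebesgue_measure]_(u in `]0%R, z[) (f1 u)%:E =
    (z `^ y * (1 - expR (- z)))%:E)%E.
  have dF (x : R) : 0 < x ->
      is_derive x 1 (fun u => u `^ y * (1 - expR (- u))) (f1 x).
    move=> x0; have D1 := @is_derive1_powR R y x x0.
    apply: is_derive_eq.
    by rewrite /f1 /GRing.scale /=; ring.
  rewrite (ge0_integral_derive_itvoo z0 dF (F0 := 0)).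
  - by rewrite subr0.
  - by move=> x x0; rewrite /f1 addr_ge0 ?f1_ge0// mulr_ge0 ?powR_ge0 ?expR_ge0.
  - have ce (x : R) : {for x, continuous (fun u : R => expR (- u))}.
      apply: continuous_comp; [exact: continuousN|exact: continuous_expR].
    move=> x x0; apply: continuousD; apply: continuousM => //.
    + by apply: continuousM; [exact: cvg_cst|exact: continuous_powR].
    + by apply: continuousB; [exact: cvg_cst|exact: ce].
    + exact: continuous_powR.
  - rewrite -[X in _ --> X](mul0r (1 - expR (- 0))); apply: cvgM; first exact: powR_cvg0.
    apply: cvgB; first exact: cvg_cst.
    apply: cvg_at_right_filter; apply: continuous_comp.
      exact: continuousN.
    exact: continuous_expR.
have E1 : (\int[lebesgue_measure]_(u in `]0%R, z[) (f1 u)%:E +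
    y%:E * lower_gamma y z =
    \int[lebesgue_measure]_(u in `]0%R, z[) (y * u `^ (y - 1))%:E +
    lower_gamma (y + 1) z)%E.
  rewrite /lower_gamma -ge0_integralZl//=; last 3 first.
  - by apply/measurable_EFinP; exact: me.
  - by move=> u _; rewrite lee_fin mulr_ge0 ?powR_ge0 ?expR_ge0.
  - by rewrite lee_fin ltW.
  rewrite -!ge0_integralD//=.
  - apply: eq_integral => u _; rewrite -EFinM -!EFinD addrK /f1; congr EFin; ring.
  - by move=> x; rewrite in_itv/= => /andP[x0 _]; rewrite lee_fin mulr_ge0 ?powR_ge0 ?ltW.
  - by apply/measurable_EFinP; apply: measurable_funM => //; exact: measurable_powR_in.
  - by move=> u _; rewrite lee_fin mulr_ge0 ?powR_ge0 ?expR_ge0.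
  - by apply/measurable_EFinP; exact: me.
  - move=> x; rewrite in_itv/= => /andP[x0 _].
    by rewrite lee_fin addr_ge0 ?f1_ge0// mulr_ge0 ?powR_ge0 ?expR_ge0.
  - apply/measurable_EFinP; apply: measurable_funD; last exact: me.
    apply: measurable_funM; first by apply: measurable_funM => //; exact: measurable_powR_in.
    apply: measurable_funB => //; apply: measurable_funS measurableT (@subsetT _ _) _.
    by apply: measurableT_comp => //; exact: measurable_expR.
  - move=> x; rewrite in_itv/= => /andP[x0 _].
    by rewrite -EFinM lee_fin ?mulr_ge0 ?powR_ge0 ?expR_ge0 ?ltW.
  - apply/measurable_EFinP; apply: measurable_funM => //; exact: me.
move: E1; rewrite If1 integral_powRB1//.
rewrite mulrBr mulr1 EFinB.
move: (y%:E * lower_gamma y z)%E (lower_gamma (y + 1) z) => [A||] [B||]//=.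
by rewrite -!EFinD => -[AB]; congr EFin; move: AB; lra.
Qed.

Lemma powR_le_expR (R : realType) (p u : R) : 0 < p -> 0 < u ->
  u `^ p <= (2 * p) `^ p * expR (u / 2).
Proof.
move=> p0 u0; pose x := u / (2 * p).
have x0 : 0 < x by rewrite divr_gt0// mulr_gt0.
have -> : u = 2 * p * x by rewrite /x mulrCA divff ?mulr1// mulf_neq0 ?gt_eqF.
rewrite powRM; [|by rewrite mulr_ge0// ltW|exact: ltW].
rewrite ler_wpM2l ?powR_ge0//.
rewrite /powR gt_eqF// ler_expR.
have -> : 2 * p * x / 2 = p * x by field.
by rewrite ler_pM2l// ltW// ln_sublinear.
Qed.

Lemma lower_gamma_ge0 (R : realType) (y z : R) : (0 <= lower_gamma y z)%E.
Proof.
by apply: integral_ge0 => u _; rewrite lee_fin mulr_ge0 ?powR_ge0 ?expR_ge0.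
Qed.

Lemma lower_gamma_bounded (R : realType) (y : R) : 0 < y ->
  exists C : R, forall z, 0 < z -> (lower_gamma y z <= C%:E)%E.
Proof.
move=> y0; pose C := (2 * y) `^ y.
have C0 : 0 <= C by exact: powR_ge0.
exists ((C + 2 * C) / y) => z z0.
have : (y%:E * lower_gamma y z <= (C + 2 * C)%:E)%E.
  rewrite lower_gammaS// EFinD; apply: leeD.
    rewrite lee_fin (le_trans (y := C * expR (z / 2) * expR (- z)))//.
      by rewrite ler_wpM2r ?expR_ge0// powR_le_expR.
    by rewrite -mulrA -expRD ler_piMr// expR_le1; lra.
  have dF (x : R) : 0 < x ->
      is_derive x 1 (fun u => - (2 * C) * expR (- (u / 2))) (C * expR (- (x / 2))).
    by move=> _; apply: is_derive_eq; rewrite /GRing.scale /=; field.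
  have ce (x : R) : {for x, continuous (fun u : R => expR (- (u / 2)))}.
    apply: (@continuous_comp _ _ _ (fun u : R => - (u / 2))); last exact: continuous_expR.
    apply: continuousN; apply: continuousM; [exact: cvg_id|exact: cvg_cst].
  have cCe (x : R) : {for x, continuous (fun u : R => C * expR (- (u / 2)))}.
    by apply: continuousM; [exact: cvg_cst|exact: ce].
  apply: (@le_trans _ _ (\int[lebesgue_measure]_(u in `]0%R, z[)
      (C * expR (- (u / 2)))%:E)%E).
    apply: ge0_le_integral => //.
    - by move=> u _; rewrite lee_fin mulr_ge0 ?powR_ge0 ?expR_ge0.
    - by apply/measurable_EFinP; exact: measurable_powR_expRN.
    - apply/measurable_EFinP; apply: open_continuous_measurable_fun.
        exact: interval_open.
      by move=> u _; exact: (cCe u).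
    - move=> u; rewrite /= in_itv/= => /andP[u0 _]; rewrite lee_fin addrK.
      rewrite (le_trans (y := C * expR (u / 2) * expR (- u)))//.
        by rewrite ler_wpM2r ?expR_ge0// powR_le_expR.
      by rewrite -mulrA -expRD ler_wpM2l// ler_expR; lra.
  rewrite (ge0_integral_derive_itvoo z0 dF (F0 := - (2 * C))).
  - by rewrite lee_fin; have := expR_ge0 (- (z / 2)); nra.
  - by move=> x _; rewrite mulr_ge0 ?expR_ge0.
  - by move=> x _; exact: cCe.
  - have E0 : - (2 * C) * expR (- (0 / 2)) = - (2 * C).
      by rewrite mul0r oppr0 expR0 mulr1.
    rewrite -[X in _ --> X]E0.
    apply: cvgM; first exact: cvg_cst.
    by apply: cvg_at_right_filter; exact: ce.
rewrite -lee_pdivlMl// => /le_trans; apply.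
by rewrite lee_fin mulrC.
Qed.

Lemma cvg_lower_gamma (R : realType) (y : R) :
  lower_gamma y n%:R @[n --> \oo] -->
  (\int[lebesgue_measure]_(u in `]0%R, +oo[) (u `^ (y - 1) * expR (- u))%:E)%E.
Proof.
rewrite itvbndyEbigcup; apply: ge0_nondecreasing_set_cvg_integral => //.
- move=> m n mn; apply/subsetPset => x /=; rewrite !in_itv/= => /andP[-> /=].
  by move=> /lt_le_trans; apply; rewrite ler_nat.
- by move=> n; apply/measurable_EFinP; exact: measurable_powR_expRN.
- by move=> n u _; rewrite lee_fin mulr_ge0 ?powR_ge0 ?expR_ge0.
Qed.

Lemma integral_Gamma (R : realType) (y : R) : 0 < y ->
  (\int[lebesgue_measure]_(u in `]0%R, +oo[) (u `^ (y - 1) * expR (- u))%:E =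
   (Gamma y)%:E)%E.
Proof.
move=> y0; rewrite /Gamma /Rintegral fineK//.
have [C HC] := lower_gamma_bounded y0.
rewrite ge0_fin_numE; last first.
  by apply: integral_ge0 => u _; rewrite lee_fin mulr_ge0 ?powR_ge0 ?expR_ge0.
rewrite (@le_lt_trans _ _ C%:E) ?ltry//.
have cg := @cvg_lower_gamma R y.
rewrite -(cvg_lim _ cg)//; apply: lime_le.
  by apply/cvg_ex; eexists; exact: cg.
near=> n; apply: HC; rewrite ltr0n; near: n.
exact: nbhs_infty_gt.
Unshelve. all: by end_near. Qed.

Lemma cvg_lower_gamma_Gamma (R : realType) (y : R) : 0 < y ->
  lower_gamma y n%:R @[n --> \oo] --> (Gamma y)%:E.
Proof. by move=> y0; rewrite -integral_Gamma//; exact: cvg_lower_gamma. Qed.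

Lemma lower_gamma_le_Gamma (R : realType) (y z : R) : 0 < y ->
  (lower_gamma y z <= (Gamma y)%:E)%E.
Proof.
move=> y0; rewrite -integral_Gamma//; apply: ge0_subset_integral => //.
- by apply/measurable_EFinP; exact: measurable_powR_expRN.
- by move=> u _; rewrite lee_fin mulr_ge0 ?powR_ge0 ?expR_ge0.
- by move=> u /=; rewrite !in_itv/= => /andP[->].
Qed.

Lemma lower_gamma_fin_num (R : realType) (y z : R) : 0 < y ->
  lower_gamma y z \is a fin_num.
Proof.
move=> y0; rewrite ge0_fin_numE ?lower_gamma_ge0//.
exact: le_lt_trans (lower_gamma_le_Gamma z y0) (ltry _).
Qed.

Lemma Gamma_gt0 (R : realType) (y : R) : 0 < y -> 0 < Gamma y.
Proof.
move=> y0; rewrite -lte_fin.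
apply: lt_le_trans (lower_gamma_le_Gamma 1 y0).
apply: (@lt_le_trans _ _ (expR (- 1) / y)%:E).
  by rewrite lte_fin divr_gt0// expR_gt0.
have -> : (expR (- 1) / y)%:E = (\int[lebesgue_measure]_(u in `]0%R, 1%R[)
    ((expR (- 1) / y)%:E * (y * u `^ (y - 1))%:E))%E.
  rewrite ge0_integralZl//.
  - by rewrite integral_powRB1// powR1 mule1.
  - by apply/measurable_EFinP; apply: measurable_funM => //; exact: measurable_powR_in.
  - by move=> u _; rewrite lee_fin mulr_ge0 ?powR_ge0 ?ltW.
  - by rewrite lee_fin divr_ge0 ?expR_ge0// ltW.
apply: ge0_le_integral => //.
- by move=> u _; rewrite -EFinM lee_fin !mulr_ge0 ?expR_ge0 ?invr_ge0 ?powR_ge0 ?(ltW y0).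
- apply: measurable_funeM; apply/measurable_EFinP.
  by apply: measurable_funM => //; exact: measurable_powR_in.
- by apply/measurable_EFinP; exact: measurable_powR_expRN.
- move=> u /=; rewrite in_itv/= => /andP[u0 u1]; rewrite -EFinM lee_fin.
  rewrite mulrA divfK ?gt_eqF// mulrC ler_wpM2l ?powR_ge0// ler_expR lerN2.
  exact: ltW.
Qed.

Lemma GammaS (R : realType) (y : R) : 0 < y -> Gamma (y + 1) = y * Gamma y.
Proof.
move=> y0; have y10 : 0 < y + 1 by rewrite addr_gt0.
apply/esym/EFin_inj.
have H1 : (y%:E * lower_gamma y n%:R)%E @[n --> \oo] --> (y * Gamma y)%:E.
  by rewrite EFinM; apply: cvgeZl => //; exact: cvg_lower_gamma_Gamma.
apply: (cvg_unique _ H1) => //=.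
have H2 : ((n%:R `^ y * expR (- n%:R))%:E + lower_gamma (y + 1) n%:R)%E
    @[n --> \oo] --> (0 + (Gamma (y + 1))%:E)%E.
  apply: cvgeD => //; last exact: cvg_lower_gamma_Gamma.
  apply: cvg_EFin; first exact: nearW.
  have : (2 * y) `^ y * expR (- n%:R * 2^-1) @[n --> \oo] --> (0 : R).
    rewrite -[X in _ --> X](mulr0 ((2 * y) `^ y)); apply: cvgM; first exact: cvg_cst.
    under eq_fun do rewrite mulNr.
    apply: (@cvg_comp _ _ _ (fun n : nat => n%:R / 2 : R)
      (fun x : R => expR (- x)) _ (pinfty_nbhs R)); last exact: cvgr_expR.
    apply/cvgryPge => A; near=> n; rewrite ler_pdivlMr//; near: n.
    exact: nbhs_infty_ger.
  apply: (squeeze_cvgr _ (cvg_cst 0)).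
  near=> n; have n0 : (0 : R) < n%:R by rewrite ltr0n; near: n; exact: nbhs_infty_gt.
  rewrite mulr_ge0 ?powR_ge0 ?expR_ge0//=.
  rewrite (le_trans (y := (2 * y) `^ y * expR (n%:R / 2) * expR (- n%:R)))//.
    by rewrite ler_wpM2r ?expR_ge0// powR_le_expR.
  by rewrite -mulrA -expRD ler_wpM2l ?powR_ge0// ler_expR; lra.
rewrite add0e in H2; apply: cvg_trans H2; apply: near_eq_cvg.
near=> n; have n0 : (0 : R) < n%:R by rewrite ltr0n; near: n; exact: nbhs_infty_gt.
by rewrite lower_gammaS.
Unshelve. all: by end_near. Qed.

Lemma integral_Gamma_scale (R : realType) (y c : R) : 0 < y -> 0 < c ->
  (\int[lebesgue_measure]_(u in `]0%R, +oo[) (u `^ (y - 1) * expR (- (c * u)))%:E =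
   (c `^ (- y) * Gamma y)%:E)%E.
Proof.
move=> y0 c0.
have := integral_Gamma y0.
rewrite (ge0_integral_scale c0)//; last 2 first.
- by apply/measurable_EFinP; exact: measurable_powR_expRN.
- by move=> u _; rewrite lee_fin mulr_ge0 ?powR_ge0 ?expR_ge0.
have -> : (fun x : R => c * x) @^-1` `]0, +oo[ = `]0, +oo[%classic.
  by apply/seteqP; split => x /=; rewrite !in_itv/= !andbT pmulr_rgt0.
have mS : measurable_fun (`]0, +oo[ : set R)
    (fun x : R => ((c * x) `^ (y - 1) * expR (- (c * x)))%:E).
  apply/measurable_EFinP; apply: measurable_funS measurableT (@subsetT _ _) _.
  apply: (@measurableT_comp _ _ _ _ _ _
    (fun x : R => x `^ (y - 1) * expR (- x)) _ (fun x : R => c * x)).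
    exact: measurable_powR_expRN.
  exact: mulrl_measurable.
rewrite powRN -ge0_integralZl//; last 2 first.
- by move=> u _; rewrite lee_fin mulr_ge0 ?powR_ge0 ?expR_ge0.
- by rewrite lee_fin ltW.
move=> H; rewrite EFinM -H -ge0_integralZl//; last 3 first.
- exact: measurable_funeM.
- by move=> u _; rewrite -EFinM lee_fin !mulr_ge0 ?powR_ge0 ?expR_ge0// ltW.
- by rewrite lee_fin invr_ge0 powR_ge0.
apply: eq_integral => u; rewrite inE/= in_itv/= andbT => u0.
rewrite -!EFinM; congr EFin; rewrite powRM ?ltW//.
rewrite !mulrA -(mulrA _ c) mulr_powRB1 ?ltW// mulVf ?mul1r//.
by rewrite gt_eqF// powR_gt0.
Qed.

(** * The Gamma distribution function *)

Definition gamma_cdf (R : realType) (y z : R) : \bar R :=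
  ((Gamma y)^-1%:E * lower_gamma y z)%E.

Lemma Gamma_ge0 (R : realType) (y : R) : 0 < y -> 0 <= Gamma y.
Proof. by move=> y0; apply: ltW; exact: Gamma_gt0. Qed.

Lemma gamma_cdf_ge0 (R : realType) (y z : R) : 0 < y -> (0 <= gamma_cdf y z)%E.
Proof.
move=> y0; rewrite mule_ge0 ?lower_gamma_ge0// lee_fin invr_ge0.
by rewrite ltW// Gamma_gt0.
Qed.

Lemma gamma_cdf_le1 (R : realType) (y z : R) : 0 < y -> (gamma_cdf y z <= 1)%E.
Proof.
move=> y0; rewrite /gamma_cdf lee_pdivrMl ?Gamma_gt0// mule1.
exact: lower_gamma_le_Gamma.
Qed.

Lemma gamma_cdfS (R : realType) (y z : R) : 0 < y -> 0 < z ->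
  (gamma_cdf y z =
   (expR (- z) * z `^ y / Gamma (y + 1))%:E + gamma_cdf (y + 1) z)%E.
Proof.
move=> y0 z0; have y10 : 0 < y + 1 by rewrite addr_gt0.
have := lower_gammaS y0 z0.
rewrite /gamma_cdf -(fineK (lower_gamma_fin_num z y0)).
rewrite -(fineK (lower_gamma_fin_num z y10)) (GammaS y0).
move: (Gamma y) (fine _) (fine _) (Gamma_gt0 y0) => g l l' g0.
rewrite -!EFinM -!EFinD => -[E]; congr EFin.
have -> : l' = (z `^ y * expR (- z) + l) / y.
  by rewrite -E mulrAC divff ?gt_eqF// mul1r.
by field; rewrite (gt_eqF g0) (gt_eqF y0).
Qed.

Lemma gamma_cdf_le (R : realType) (y z : R) : 0 < y -> 0 < z ->
  (gamma_cdf y z <= (z `^ y / Gamma (y + 1))%:E)%E.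
Proof.
move=> y0 z0; have G0 := Gamma_gt0 y0.
rewrite /gamma_cdf lee_pdivrMl// GammaS//.
have -> : ((Gamma y)%:E * (z `^ y / (y * Gamma y))%:E = (y^-1)%:E * (z `^ y)%:E)%E.
  by rewrite -!EFinM; congr EFin; field; rewrite !gt_eqF.
rewrite lee_pdivlMl// -integral_powRB1// /lower_gamma -ge0_integralZl//.
- apply: ge0_le_integral => //.
  + by move=> u _; rewrite -EFinM lee_fin !mulr_ge0 ?powR_ge0 ?expR_ge0// ltW.
  + by apply: measurable_funeM; apply/measurable_EFinP; exact: measurable_powR_expRN.
  + apply/measurable_EFinP; apply: measurable_funM => //.
    exact: measurable_powR_in.
  + move=> u /=; rewrite in_itv/= => /andP[u0 _].
    rewrite -EFinM lee_fin ler_wpM2l ?(ltW y0)// ler_piMr ?powR_ge0//.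
    by rewrite expR_le1 oppr_le0 ltW.
- by apply/measurable_EFinP; exact: measurable_powR_expRN.
- by move=> u _; rewrite lee_fin mulr_ge0 ?powR_ge0 ?expR_ge0.
- by rewrite lee_fin ltW.
Qed.

Lemma fact_Gamma_le (R : realType) (y : R) (n : nat) : 1 <= y ->
  n`!%:R * Gamma y <= Gamma (y + n%:R).
Proof.
move=> y1; have y0 : 0 < y by exact: lt_le_trans y1.
elim: n => [|n IH]; first by rewrite fact0 mul1r addr0.
have yn0 : 0 < y + n%:R by rewrite ltr_wpDr.
rewrite -natr1 addrA (GammaS yn0) factS natrM -mulrA.
apply: (ler_pM _ _ _ IH); first exact: ler0n.
  by apply: mulr_ge0; [exact: ler0n|exact: Gamma_ge0].
by rewrite -natr1 [leRHS]addrC lerD2l.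
Qed.

Lemma gamma_cdf_series (R : realType) (y z : R) : 0 < y -> 0 < z ->
  (\sum_(0 <= n <oo) (expR (- z) * z `^ (n%:R + y) / Gamma (n%:R + y + 1))%:E =
   gamma_cdf y z)%E.
Proof.
move=> y0 z0.
have yn0 (n : nat) : 0 < n%:R + y by rewrite ltr_wpDl.
have PS (n : nat) : (gamma_cdf y z = \sum_(0 <= k < n)
   (expR (- z) * z `^ (k%:R + y) / Gamma (k%:R + y + 1))%:E + gamma_cdf (n%:R + y) z)%E.
  elim: n => [|n ->]; first by rewrite big_geq// add0e add0r.
  rewrite (big_nat_recr _ _ _ (leq0n n))/= -addeA; congr (_ + _)%E.
  rewrite (gamma_cdfS (yn0 n) z0) (_ : n.+1%:R + y = n%:R + y + 1)//.
  by rewrite -natr1 addrAC.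
have C0 : 0 <= z `^ y / Gamma (y + 1).
  apply: divr_ge0; first exact: powR_ge0.
  by apply: Gamma_ge0; rewrite addr_gt0.
have rest : gamma_cdf (n%:R + y) z @[n --> \oo] --> 0%E.
  apply: (squeeze_cvge _ (cvg_cst 0%E)
    (h := fun n => (z `^ y / Gamma (y + 1) * exp_coeff z n)%:E)).
    near=> n; rewrite gamma_cdf_ge0//=.
    apply: le_trans (gamma_cdf_le (yn0 n) z0) _.
    rewrite lee_fin exp_coeffE powRD ?(gt_eqF z0) ?implybT// powR_mulrn ?(ltW z0)//.
    have G1 : 0 < Gamma (y + 1) by apply: Gamma_gt0; rewrite addr_gt0.
    have : n`!%:R * Gamma (y + 1) <= Gamma (n%:R + y + 1).
      by rewrite -addrA [(_ + (y + 1))]addrC; apply: fact_Gamma_le; rewrite lerDr ltW.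
    move: (Gamma (n%:R + y + 1)) => h; move: (Gamma (y + 1)) G1 => g g0 gh.
    have f0 : 0 < n`!%:R :> R by rewrite ltr0n fact_gt0.
    have -> : z `^ y / g * (n`!%:R^-1 * z ^+ n) = z ^+ n * z `^ y / (n`!%:R * g).
      by field; rewrite !gt_eqF.
    rewrite ler_wpM2l ?mulr_ge0 ?powR_ge0 ?exprn_ge0 ?(ltW z0)//.
    by rewrite lef_pV2 ?posrE ?(lt_le_trans _ gh) ?mulr_gt0.
  apply: cvg_EFin; first exact: nearW.
  rewrite -[X in _ --> X](mulr0 (z `^ y / Gamma (y + 1))).
  apply: cvgM; first exact: cvg_cst.
  exact: cvg_series_cvg_0 (is_cvg_series_exp_coeff z).
have F n : gamma_cdf (n%:R + y) z \is a fin_num.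
  rewrite ge0_fin_numE ?gamma_cdf_ge0//.
  exact: le_lt_trans (gamma_cdf_le1 _ (yn0 n)) (ltry _).
apply/cvg_lim => //.
have -> : (fun n => \sum_(0 <= k < n)
   (expR (- z) * z `^ (k%:R + y) / Gamma (k%:R + y + 1))%:E)%E =
  (fun n => gamma_cdf y z - gamma_cdf (n%:R + y) z)%E.
  by apply/funext => n; rewrite [in RHS](PS n) addeK.
rewrite -[X in _ --> X]sube0; apply: cvgeB => //; last exact: cvg_cst.
by rewrite fin_num_adde_defl.
Unshelve. all: by end_near.
Qed.

(* Chernoff bounds: exponential tilting e^(-u) = e^((c - 1) u) e^(-c u). *)
Lemma gamma_cdf_le_expR (R : realType) (y z c : R) : 0 < y -> 1 <= c ->
  (gamma_cdf y z <= (expR ((c - 1) * z) * c `^ (- y))%:E)%E.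
Proof.
move=> y0 c1; have c0 : 0 < c by exact: lt_le_trans c1.
have Gc := integral_Gamma_scale y0 c0.
have mc : measurable_fun (`]0, +oo[ : set R)
    (fun u : R => (u `^ (y - 1) * expR (- (c * u)))%:E).
  by apply/measurable_EFinP; exact: measurable_powR_expRNM.
rewrite /gamma_cdf lee_pdivrMl ?Gamma_gt0//.
have -> : ((Gamma y)%:E * (expR ((c - 1) * z) * c `^ (- y))%:E =
    (expR ((c - 1) * z))%:E * \int[lebesgue_measure]_(u in `]0%R, +oo[)
      (u `^ (y - 1) * expR (- (c * u)))%:E)%E.
  by rewrite Gc -!EFinM; congr EFin; ring.
rewrite -ge0_integralZl//; last first.
  by move=> u _; rewrite lee_fin mulr_ge0 ?powR_ge0 ?expR_ge0.
have sz : `]0, z[ `<=` (`]0, +oo[%classic : set R).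
  by move=> u /=; rewrite !in_itv/= andbT => /andP[].
have mK : measurable_fun (`]0, +oo[ : set R) (fun u : R =>
    ((expR ((c - 1) * z))%:E * (u `^ (y - 1) * expR (- (c * u)))%:E)%E).
  exact: measurable_funeM.
apply: (@le_trans _ _ (\int[lebesgue_measure]_(u in `]0%R, z[)
    ((expR ((c - 1) * z))%:E * (u `^ (y - 1) * expR (- (c * u)))%:E))%E).
  apply: ge0_le_integral => //.
  - by move=> u _; rewrite lee_fin mulr_ge0 ?powR_ge0 ?expR_ge0.
  - by apply/measurable_EFinP; exact: measurable_powR_expRN.
  - exact: measurable_funS mK.
  - move=> u /=; rewrite in_itv/= => /andP[u0 uz].
    rewrite -EFinM lee_fin mulrCA ler_wpM2l ?powR_ge0// -expRD ler_expR.
    have : 0 <= (c - 1) * (z - u) by rewrite mulr_ge0// subr_ge0// ltW.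
    lra.
apply: ge0_subset_integral => //.
by move=> u _; rewrite -EFinM lee_fin !mulr_ge0 ?powR_ge0 ?expR_ge0.
Qed.

Lemma gamma_cdf_ge_expR (R : realType) (y z c : R) : 0 < y -> 0 < z ->
  0 < c <= 1 -> (1 <= gamma_cdf y z + (expR ((c - 1) * z) * c `^ (- y))%:E)%E.
Proof.
move=> y0 z0 /andP[c0 c1].
have Gc := integral_Gamma_scale y0 c0.
have G0 := Gamma_gt0 y0.
have mc : measurable_fun (`]0, +oo[ : set R)
    (fun u : R => (u `^ (y - 1) * expR (- (c * u)))%:E).
  by apply/measurable_EFinP; exact: measurable_powR_expRNM.
have -> : (expR ((c - 1) * z) * c `^ (- y))%:E =
    ((Gamma y)^-1%:E * ((expR ((c - 1) * z))%:E *
      \int[lebesgue_measure]_(u in `]0%R, +oo[)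
      (u `^ (y - 1) * expR (- (c * u)))%:E))%E.
  by rewrite Gc -!EFinM; congr EFin; field; rewrite gt_eqF.
rewrite /gamma_cdf -ge0_muleDr ?lower_gamma_ge0//; last first.
  rewrite mule_ge0 ?lee_fin ?expR_ge0// integral_ge0// => u _.
  by rewrite lee_fin mulr_ge0 ?powR_ge0 ?expR_ge0.
rewrite lee_pdivlMl// mule1 -integral_Gamma//.
rewrite -ge0_integralZl//; last first.
  by move=> u _; rewrite lee_fin mulr_ge0 ?powR_ge0 ?expR_ge0.
pose g : R -> \bar R :=
  (fun u : R => (u `^ (y - 1) * expR (- u))%:E) \_ (`]0, z[ : set R).
have mz : measurable_fun (`]0, +oo[ : set R) g.
  apply: measurable_funS measurableT (@subsetT _ _) _.
  apply: (iffLR (measurable_restrictT _ _)) => //.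
  by apply/measurable_EFinP; exact: measurable_powR_expRN.
have -> : lower_gamma y z = (\int[lebesgue_measure]_(u in `]0%R, +oo[) g u)%E.
  rewrite -integral_mkcondr /lower_gamma; congr integral.
  apply/seteqP; split => u /=; rewrite !in_itv/= ?andbT.
    by move=> /andP[-> ->].
  by move=> [_ ->].
rewrite -ge0_integralD//; last 3 first.
- move=> u _; apply: erestrict_ge0 => v _.
  by rewrite lee_fin mulr_ge0 ?powR_ge0 ?expR_ge0.
- by move=> u _; rewrite mule_ge0 ?lee_fin ?expR_ge0// mulr_ge0 ?powR_ge0 ?expR_ge0.
- exact: measurable_funeM.
apply: ge0_le_integral => //.
- by move=> u _; rewrite lee_fin mulr_ge0 ?powR_ge0 ?expR_ge0.
- by apply/measurable_EFinP; exact: measurable_powR_expRN.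
- by apply: emeasurable_funD => //; exact: measurable_funeM.
- move=> u /=; rewrite in_itv/= andbT => u0.
  rewrite /g patchE; case: ifPn => [_|].
    by rewrite leeDl// mule_ge0 ?lee_fin ?expR_ge0// mulr_ge0 ?powR_ge0 ?expR_ge0.
  rewrite notin_setE/= in_itv/= u0/= => /negP; rewrite -leNgt => zu.
  rewrite add0e -EFinM lee_fin mulrCA ler_wpM2l ?powR_ge0// -expRD ler_expR.
  have : 0 <= (1 - c) * (u - z) by rewrite mulr_ge0// subr_ge0// ltW.
  lra.
Qed.

(** * Tonelli on product domains *)

Lemma measurable_integral_snd (d1 d2 : measure_display) (T1 : measurableType d1)
    (T2 : measurableType d2) (R : realType)
    (m2 : {sigma_finite_measure set T2 -> \bar R}) (D1 : set T1) (D2 : set T2)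
    (f : T1 * T2 -> \bar R) :
  measurable D1 -> measurable D2 -> measurable_fun (D1 `*` D2) f ->
  (forall z, (D1 `*` D2) z -> (0 <= f z)%E) ->
  measurable_fun D1 (fun x => (\int[m2]_(y in D2) f (x, y))%E).
Proof.
move=> mD1 mD2 mf f0.
pose g := f \_ (D1 `*` D2).
have mD : measurable (D1 `*` D2) by exact: measurableX.
have mg : measurable_fun setT g by exact: (iffLR (measurable_restrictT _ _)).
have g0 z : (0 <= g z)%E by apply: erestrict_ge0.
have := measurable_fun_fubini_tonelli_F (m2 := m2) g mg g0.
move=> /(measurable_funS measurableT (@subsetT _ D1)).
apply: eq_measurable_fun => x; rewrite inE => D1x.
rewrite /fubini_F [RHS]integral_mkcond; apply: eq_integral => y _.
rewrite /g !patchE; case: ifPn; rewrite ?inE ?notin_setE /= => h.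
  by rewrite ifT// inE; case: h.
by rewrite ifF//; apply: negbTE; rewrite notin_setE => D2y; exact: h.
Qed.

Lemma tonelli_on (d1 d2 : measure_display) (T1 : measurableType d1)
    (T2 : measurableType d2) (R : realType)
    (m1 : {sigma_finite_measure set T1 -> \bar R})
    (m2 : {sigma_finite_measure set T2 -> \bar R}) (D1 : set T1) (D2 : set T2)
    (f : T1 * T2 -> \bar R) :
  measurable D1 -> measurable D2 -> measurable_fun (D1 `*` D2) f ->
  (forall z, (D1 `*` D2) z -> (0 <= f z)%E) ->
  (\int[m1]_(x in D1) \int[m2]_(y in D2) f (x, y) =
   \int[m2]_(y in D2) \int[m1]_(x in D1) f (x, y))%E.
Proof.
move=> mD1 mD2 mf f0.
pose g := f \_ (D1 `*` D2).
have mD : measurable (D1 `*` D2) by exact: measurableX.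
have mg : measurable_fun setT g by exact: (iffLR (measurable_restrictT _ _)).
have g0 z : (0 <= g z)%E by apply: erestrict_ge0.
have gE x y : g (x, y) = if (x \in D1) && (y \in D2) then f (x, y) else 0%E.
  rewrite /g patchE; congr (if _ then _ else _).
  by apply/idP/andP; rewrite !inE.
rewrite [LHS]integral_mkcond [RHS]integral_mkcond.
transitivity (\int[m1]_x \int[m2]_y g (x, y))%E.
  apply: eq_integral => x _; rewrite patchE; case: ifPn => Dx; last first.
    by rewrite integral0_eq// => y _; rewrite gE (negbTE Dx).
  rewrite [LHS]integral_mkcond; apply: eq_integral => y _.
  by rewrite gE Dx/= patchE.
transitivity (\int[m2]_y \int[m1]_x g (x, y))%E.
  exact: (fubini_tonelli (m1 := m1) (m2 := m2) g mg g0).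
apply: eq_integral => y _; rewrite patchE; case: ifPn => Dy; last first.
  by rewrite integral0_eq// => x _; rewrite gE (negbTE Dy) andbF.
rewrite [RHS]integral_mkcond; apply: eq_integral => x _.
by rewrite gE Dy andbT patchE.
Qed.

Lemma measurable_gamma_kernel (R : realType) (D2 : set R) :
  measurable D2 -> (forall u, D2 u -> 0 < u) ->
  measurable_fun ((`]0, +oo[ : set R) `*` D2)
    (fun z : R * R => (z.2 `^ (z.1 - 1) * expR (- z.2))%:E).
Proof.
move=> mD2 D2_gt0; apply/measurable_EFinP; apply: measurable_funM.
  apply: (@eq_measurable_fun _ _ _ _ _ (fun z : R * R => expR ((z.1 - 1) * ln z.2))).
    by move=> z; rewrite inE => -[_ /D2_gt0 z0]; rewrite /powR gt_eqF.
  apply: measurable_funS measurableT (@subsetT _ _) _.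
  apply: measurableT_comp; first exact: measurable_expR.
  apply: measurable_funM; first by apply: measurable_funB => //; exact: measurable_fst.
  by apply: measurableT_comp; [exact: measurable_ln|exact: measurable_snd].
apply: measurable_funS measurableT (@subsetT _ _) _.
apply: measurableT_comp; first exact: measurable_expR.
by apply: measurableT_comp; [exact: oppr_measurable|exact: measurable_snd].
Qed.

Lemma measurable_lower_gamma (R : realType) (z : R) :
  measurable_fun (`]0, +oo[ : set R) (fun y => lower_gamma y z).
Proof.
apply: (@measurable_integral_snd _ _ _ _ _ lebesgue_measure _ _
   (fun z : R * R => (z.2 `^ (z.1 - 1) * expR (- z.2))%:E)) => //.
- by apply: measurable_gamma_kernel => // u /=; rewrite in_itv/= => /andP[].
- by move=> p _; rewrite lee_fin mulr_ge0 ?powR_ge0 ?expR_ge0.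
Qed.

Lemma measurable_Gamma (R : realType) :
  measurable_fun (`]0, +oo[ : set R) (@Gamma R).
Proof.
have H : measurable_fun (`]0, +oo[ : set R) (fun y : R =>
    (\int[lebesgue_measure]_(u in `]0%R, +oo[) (u `^ (y - 1) * expR (- u))%:E)%E).
  apply: (@measurable_integral_snd _ _ _ _ _ lebesgue_measure _ _
    (fun z : R * R => (z.2 `^ (z.1 - 1) * expR (- z.2))%:E)) => //.
  - by apply: measurable_gamma_kernel => // u /=; rewrite in_itv/= andbT.
  - by move=> p _; rewrite lee_fin mulr_ge0 ?powR_ge0 ?expR_ge0.
apply/measurable_EFinP; apply: eq_measurable_fun H => y.
by rewrite inE/= in_itv/= andbT => y0; exact: integral_Gamma.
Qed.

Lemma measurable_gamma_cdf (R : realType) (z : R) :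
  measurable_fun (`]0, +oo[ : set R) (fun y => gamma_cdf y z).
Proof.
apply: emeasurable_funM; last exact: measurable_lower_gamma.
apply/measurable_EFinP.
apply: (@eq_measurable_fun _ _ _ _ _ (fun y : R => Gamma y `^ (- 1))).
  move=> y; rewrite inE/= in_itv/= andbT => y0.
  by rewrite powR_inv1//; exact: Gamma_ge0.
apply: (@measurableT_comp _ _ _ _ _ _ (fun x : R => x `^ (- 1))).
  exact: measurable_powR.
exact: measurable_Gamma.
Qed.

(** * Moments of the Gamma distribution function in its parameter *)

Lemma gamma_cdfE (R : realType) (y z : R) :
  gamma_cdf y z = ((Gamma y)^-1%:E * lower_gamma y z)%E.
Proof. by []. Qed.

(* Otherwise unification keeps unfolding the integrals behind these constants. *)
Opaque gamma_cdf Gamma.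

Lemma rGammaE (R : realType) (x : R) : 0 < x -> rGamma x = (Gamma x)^-1.
Proof. by rewrite /rGamma => ->. Qed.

Definition gamma_cdf_moment (R : realType) (q z : R) : \bar R :=
  (\int[lebesgue_measure]_(y in `]0%R, +oo[) ((y `^ (q - 1))%:E * gamma_cdf y z))%E.

Lemma measurable_invGamma (R : realType) (c : R) : 0 <= c ->
  measurable_fun (`]0, +oo[ : set R) (fun y : R => (Gamma (c + y))^-1).
Proof.
move=> c0; apply: (@eq_measurable_fun _ _ _ _ _ (fun y : R => Gamma (c + y) `^ (- 1))).
  move=> y; rewrite inE/= in_itv/= andbT => y0.
  by apply: powR_inv1; apply: Gamma_ge0; rewrite ltr_wpDl.
apply: (@measurableT_comp _ _ _ _ _ _ (fun x : R => x `^ (- 1))).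
  exact: measurable_powR.
apply: (@measurable_comp _ _ _ _ _ _ (`]0, +oo[ : set R) (@Gamma R) _
    (fun y : R => c + y)) => //.
- move=> x [y /=]; rewrite in_itv/= andbT => y0 <-.
  by rewrite in_itv/= andbT ltr_wpDl.
- exact: measurable_Gamma.
- by apply: measurable_funD => //; exact: measurable_id.
Qed.

Lemma nneseries_mu (R : realType) (q z : R) : 0 < q -> 0 < z ->
  (\sum_(0 <= n <oo) ((expR (- z))%:E * mu z (q - 1) n%:R) =
   (Gamma q)^-1%:E * gamma_cdf_moment q z)%E.
Proof.
move=> q0 z0.
have Gq0 := Gamma_gt0 q0.
pose h (n : nat) (y : R) : R := expR (- z) * z `^ (n%:R + y) / Gamma (n%:R + y + 1).
have h0 n y : 0 < y -> 0 <= h n y.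
  move=> y0; apply: mulr_ge0; first by rewrite mulr_ge0 ?expR_ge0 ?powR_ge0.
  by rewrite invr_ge0; apply: Gamma_ge0; rewrite addr_gt0// ltr_wpDl.
have mh n : measurable_fun (`]0, +oo[ : set R) (h n).
  apply: measurable_funM; last first.
    have n1 : 0 <= n%:R + 1 :> R by rewrite addr_ge0.
    apply: eq_measurable_fun (measurable_invGamma n1) => y _.
    by rewrite addrAC.
  apply: measurable_funM => //.
  apply: (@eq_measurable_fun _ _ _ _ _ (fun y : R => expR ((n%:R + y) * ln z))).
    by move=> y _; rewrite /powR (gt_eqF z0).
  apply: measurableT_comp; first exact: measurable_expR.
  apply: measurable_funM => //.
  by apply: measurable_funD => //; exact: measurable_id.
pose g n y : \bar R := ((y `^ (q - 1) / Gamma q)%:E * (h n y)%:E)%E.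
have g0 n y : 0 < y -> (0 <= g n y)%E.
  move=> y0; rewrite /g -EFinM lee_fin; apply: mulr_ge0; last exact: h0.
  by apply: mulr_ge0; [exact: powR_ge0|rewrite invr_ge0 ltW].
have mg n : measurable_fun (`]0, +oo[ : set R) (g n).
  apply: emeasurable_funM; apply/measurable_EFinP; last exact: mh.
  by apply: measurable_funM => //; exact: measurable_powR_in.
have E n : ((expR (- z))%:E * mu z (q - 1) n%:R =
    \int[lebesgue_measure]_(y in `]0%R, +oo[) g n y)%E.
  transitivity ((expR (- z))%:E * \int[lebesgue_measure]_(y in `]0%R, +oo[)
     ((expR z)%:E * g n y))%E.
    congr (_ * _)%E; apply: eq_integral => y; rewrite inE/= in_itv/= andbT => y0.
    have ny0 : 0 < n%:R + y + 1 by rewrite addr_gt0// ltr_wpDl.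
    rewrite (rGammaE ny0) subrK (rGammaE q0) /g /h -!EFinM; congr EFin.
    rewrite expRN; move: (Gamma q) (Gamma (n%:R + y + 1)) => g1 g2.
    rewrite [RHS](_ : _ = expR z / expR z *
      (z `^ (n%:R + y) * y `^ (q - 1) * (g1^-1 * g2^-1))); last by ring.
    by rewrite divff ?mul1r// gt_eqF// expR_gt0.
  rewrite ge0_integralZl//; last 2 first.
  - exact: mg.
  - by move=> y; rewrite /= in_itv/= andbT => /(g0 n).
  by rewrite muleA -EFinM -expRD addNr expR0 mul1e.
under eq_eseriesr do rewrite E.
rewrite -integral_nneseries//; last first.
  by move=> n y; rewrite /= in_itv/= andbT => /(g0 n).
rewrite /gamma_cdf_moment -ge0_integralZl//.
- apply: eq_integral => y; rewrite inE/= in_itv/= andbT => y0.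
  rewrite nneseriesZl; last by move=> n _; rewrite lee_fin h0.
  rewrite gamma_cdf_series// [RHS]muleA; congr (_ * _)%E.
  by rewrite -EFinM mulrC.
- apply: emeasurable_funM; last exact: measurable_gamma_cdf.
  by apply/measurable_EFinP; exact: measurable_powR_in.
- move=> y; rewrite /= in_itv/= andbT => y0.
  by rewrite mule_ge0 ?lee_fin ?powR_ge0 ?gamma_cdf_ge0.
- by rewrite lee_fin invr_ge0 ltW.
Qed.

Lemma integral_mu (R : realType) (q b t : R) : 0 < q -> 0 < b -> 0 < t ->
  (\int[lebesgue_measure]_(s in `]0%R, t[)
     ((expR (- (b * s)))%:E * mu (b * s) (q - 1) (- 1)) =
   ((b * Gamma q)^-1)%:E * gamma_cdf_moment q (b * t))%E.
Proof.
move=> q0 b0 t0.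
have Gq0 := Gamma_gt0 q0.
pose w (y : R) : R := y `^ (q - 1) / Gamma q / Gamma y.
have w0 y : 0 < y -> 0 <= w y.
  move=> y0; apply: divr_ge0; last exact: Gamma_ge0.
  by apply: divr_ge0; [exact: powR_ge0|exact: ltW].
have mw : measurable_fun (`]0, +oo[ : set R) w.
  apply: measurable_funM; first by apply: measurable_funM => //; exact: measurable_powR_in.
  apply: eq_measurable_fun (@measurable_invGamma R 0 _) => // y _.
  by rewrite add0r.
pose k (z : R * R) : \bar R := ((z.1 `^ (z.2 - 1) * expR (- z.1))%:E * (w z.2)%:E)%E.
pose f (u : R) : \bar R := (\int[lebesgue_measure]_(y in `]0%R, +oo[) k (u, y))%E.
have k0 (D1 D2 : set R) : D2 `<=` `]0, +oo[ ->
    forall z, (D1 `*` D2) z -> (0 <= k z)%E.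
  move=> D20 z [_ /D20]; rewrite /= in_itv/= andbT => z0.
  by rewrite mule_ge0 ?lee_fin ?w0// mulr_ge0 ?powR_ge0 ?expR_ge0.
pose D1 : set R := `]0, b * t[%classic.
pose D2 : set R := `]0, +oo[%classic.
have mD1 : measurable D1 by exact: measurable_itv.
have mD2 : measurable D2 by exact: measurable_itv.
have mk : measurable_fun (D1 `*` D2) k.
  apply: emeasurable_funM; apply/measurable_EFinP.
    apply: measurable_funM.
      apply: (@eq_measurable_fun _ _ _ _ _ (fun z : R * R => expR ((z.2 - 1) * ln z.1))).
        move=> z; rewrite inE => -[]; rewrite /D1/= in_itv/= => /andP[z0 _] _.
        by rewrite /powR gt_eqF.
      apply: measurable_funS measurableT (@subsetT _ _) _.
      apply: measurableT_comp; first exact: measurable_expR.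
      apply: measurable_funM.
        by apply: measurable_funB => //; exact: measurable_snd.
      by apply: measurableT_comp; [exact: measurable_ln|exact: measurable_fst].
    apply: measurable_funS measurableT (@subsetT _ _) _.
    apply: measurableT_comp; first exact: measurable_expR.
    by apply: measurableT_comp; [exact: oppr_measurable|exact: measurable_fst].
  apply: (@measurable_comp _ _ _ _ _ _ D2 w _ (fun z : R * R => z.2)) => //.
    by move=> x [z [_ ?] <-].
  exact: measurable_funS measurableT (@subsetT _ _) measurable_snd.
have mf : measurable_fun D1 f.
  apply: (@measurable_integral_snd _ _ _ _ _ lebesgue_measure _ _ k) => //.
  exact: k0.
have f0 u : (0 <= f u)%E.
  by apply: integral_ge0 => y D2y; apply: (@k0 setT D2).
have fE u : D1 u -> f u = ((expR (- u))%:E * mu u (q - 1) (- 1))%E.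
  rewrite /D1/= in_itv/= => /andP[u0 _].
  transitivity ((expR (- u))%:E * \int[lebesgue_measure]_(y in `]0%R, +oo[)
     ((u `^ (y - 1))%:E * (w y)%:E))%E; last first.
    congr (_ * _)%E; apply: eq_integral => y; rewrite inE/= in_itv/= andbT => y0.
    have y1 : 0 < - 1 + y + 1 by rewrite addrAC addNr add0r.
    rewrite (rGammaE y1) subrK (rGammaE q0) -EFinM; congr EFin.
    rewrite [- 1 + y]addrC subrK /w.
    by move: (Gamma q) (Gamma y) => g1 g2; ring.
  rewrite -ge0_integralZl//.
  - by apply: eq_integral => y _; rewrite /k/= muleA -EFinM [(_ * expR _)%R]mulrC.
  - apply: emeasurable_funM; apply/measurable_EFinP; last exact: mw.
    apply: (@eq_measurable_fun _ _ _ _ _ (fun y : R => expR ((y - 1) * ln u))).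
      by move=> y _; rewrite /powR (gt_eqF u0).
    apply: measurable_funS measurableT (@subsetT _ _) _.
    apply: measurableT_comp; first exact: measurable_expR.
    by apply: measurable_funM => //; apply: measurable_funB.
  - move=> y; rewrite /= in_itv/= andbT => y0.
    by rewrite -EFinM lee_fin mulr_ge0 ?powR_ge0 ?w0.
have SC := ge0_integral_scale b0 mD1 mf (fun u _ => f0 u).
have D1E : (fun s : R => b * s) @^-1` D1 = `]0, t[%classic.
  apply/seteqP; split => s /=; rewrite /D1/= !in_itv/= pmulr_rgt0// ltr_pM2l//.
transitivity (\int[lebesgue_measure]_(s in `]0%R, t[) f (b * s)%R)%E.
  apply: eq_integral => s; rewrite inE -D1E => sD; exact/esym/fE.
have -> : (\int[lebesgue_measure]_(s in `]0%R, t[) f (b * s)%R =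
    b^-1%:E * \int[lebesgue_measure]_(u in D1) f u)%E.
  by rewrite SC D1E muleA -EFinM mulVf ?gt_eqF// mul1e.
rewrite (tonelli_on lebesgue_measure lebesgue_measure mD1 mD2 mk); last exact: k0.
rewrite invfM EFinM -muleA; congr (_ * _)%E.
rewrite /gamma_cdf_moment -ge0_integralZl//; last 3 first.
- apply: emeasurable_funM; last exact: measurable_gamma_cdf.
  by apply/measurable_EFinP; exact: measurable_powR_in.
- move=> y; rewrite /= in_itv/= andbT => y0.
  by rewrite mule_ge0 ?lee_fin ?powR_ge0 ?gamma_cdf_ge0.
- by rewrite lee_fin invr_ge0 ltW.
apply: eq_integral => y; rewrite inE /D2/= in_itv/= andbT => y0.
rewrite /k/= ge0_integralZr//; last 3 first.
- by apply/measurable_EFinP; exact: measurable_powR_expRN.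
- by move=> u _; rewrite lee_fin mulr_ge0 ?powR_ge0 ?expR_ge0.
- by rewrite lee_fin w0.
rewrite gamma_cdfE muleC /lower_gamma -/D1.
rewrite 2![RHS]muleA; congr (_ * _)%E.
by rewrite /w; move: (Gamma q) (Gamma y) => g1 g2; rewrite -!EFinM; congr EFin; ring.
Qed.

Lemma gamma_rate_gt0 (R : realType) (v : R) : 0 < v -> v != 1 ->
  0 < 1 - v + v * ln v.
Proof.
move=> v0 v1; have lv0 : - ln v != 0 by rewrite oppr_eq0 ln_eq0.
have := expR_gt1Dx lv0; rewrite expRN lnK ?posrE//.
rewrite -(ltr_pM2l v0) divff ?gt_eqF// mulrDr mulr1 mulrN.
lra.
Qed.

Lemma cvg_gamma_cdf_scaled (R : realType) (v : R) (u : R^nat) :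
  0 < v -> v != 1 -> (forall n, 0 < u n) -> u n @[n --> \oo] --> +oo ->
  gamma_cdf (u n * v) (u n) @[n --> \oo] --> (if (v < 1)%R then 1 else 0)%E.
Proof.
move=> v0 v1 u0 uy; pose k := 1 - v + v * ln v.
have k0 : 0 < k by exact: gamma_rate_gt0.
have E n : expR ((v - 1) * u n) * v `^ (- (u n * v)) = expR (- (u n * k)).
  by rewrite /powR (gt_eqF v0) -expRD; congr expR; rewrite /k; ring.
have ek : (expR (- (u n * k)))%:E @[n --> \oo] --> 0%E.
  apply: cvg_EFin; first exact: nearW.
  apply: (@cvg_comp _ _ _ (fun n => u n * k) (fun x : R => expR (- x)) _
    (pinfty_nbhs R)); last exact: cvgr_expR.
  apply/cvgryPge => A.
  have /cvgryPge /(_ (A / k)) := uy.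
  by apply: filterS => n; rewrite ler_pdivrMr.
have uv n : 0 < u n * v by rewrite mulr_gt0.
have [vl|vg] := ltP v 1.
  apply: (squeeze_cvge _ (f := fun n => (1 - (expR (- (u n * k)))%:E)%E)
    (h := fun=> 1%E)).
  - near=> n; rewrite gamma_cdf_le1// andbT leeBlDr//.
    by rewrite -E gamma_cdf_ge_expR// v0 ltW.
  - rewrite -[X in _ --> X]sube0; apply: cvgeB => //; exact: cvg_cst.
  - exact: cvg_cst.
apply: (squeeze_cvge _ (f := fun n => 0%E)
  (h := fun n => (expR (- (u n * k)))%:E)).
- near=> n; rewrite gamma_cdf_ge0//=.
  by rewrite -E; exact: gamma_cdf_le_expR.
- exact: cvg_cst.
- exact: ek.
Unshelve. all: by end_near. Qed.

Lemma gamma_cdf_scaled_le (R : realType) (v z : R) : 0 < v -> 1 <= z ->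
  (gamma_cdf (z * v) z <= (expR 1 * expR (- (ln 2 * v)))%:E)%E.
Proof.
move=> v0 z1; have z0 : 0 < z by exact: lt_le_trans z1.
rewrite -expRD; have zv : 0 < z * v by rewrite mulr_gt0.
have [h|h] := leP (ln 2 * v) 1.
  apply: le_trans (gamma_cdf_le1 _ zv) _.
  by rewrite lee_fin -[leLHS]expR0 ler_expR; lra.
apply: le_trans (gamma_cdf_le_expR z zv (_ : 1 <= 2)) _.
  by rewrite ler1n.
rewrite lee_fin /powR pnatr_eq0/= -expRD ler_expR.
have : 0 <= (z - 1) * (ln 2 * v - 1) by rewrite mulr_ge0 ?subr_ge0// ltW.
lra.
Qed.

Lemma measurable_gamma_cdf_scaled (R : realType) (q c z : R) : 0 < c ->
  measurable_fun (`]0, +oo[ : set R)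
    (fun v => (v `^ (q - 1))%:E * gamma_cdf (c * v) z)%E.
Proof.
move=> c0; apply: emeasurable_funM.
  apply/measurable_EFinP.
  exact: measurable_powR_in.
apply: (@measurable_comp _ _ _ _ _ _ (`]0, +oo[ : set R)
  (fun y => gamma_cdf y z) _ (fun v : R => c * v)) => //.
- move=> x [y /=]; rewrite in_itv/= andbT => y0 <-.
  by rewrite in_itv/= andbT mulr_gt0.
- exact: measurable_gamma_cdf.
- by apply: measurable_funM.
Qed.

Definition gamma_cdf_scaled_moment (R : realType) (q z : R) : \bar R :=
  (\int[lebesgue_measure]_(v in `]0%R, +oo[)
     ((v `^ (q - 1))%:E * gamma_cdf (z * v) z))%E.

Lemma gamma_cdf_moment_scale (R : realType) (q c z : R) : 0 < q -> 0 < c ->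
  (gamma_cdf_moment q z = (c `^ q)%:E * \int[lebesgue_measure]_(v in `]0%R, +oo[)
     ((v `^ (q - 1))%:E * gamma_cdf (c * v) z))%E.
Proof.
move=> q0 c0.
have mF : measurable_fun (`]0, +oo[ : set R)
    (fun y => (y `^ (q - 1))%:E * gamma_cdf y z)%E.
  apply: emeasurable_funM; last exact: measurable_gamma_cdf.
  by apply/measurable_EFinP; exact: measurable_powR_in.
have F0 (y : R) : `]0, +oo[%classic y -> (0 <= (y `^ (q - 1))%:E * gamma_cdf y z)%E.
  rewrite /= in_itv/= andbT => y0.
  by apply: mule_ge0; [rewrite lee_fin powR_ge0|exact: gamma_cdf_ge0].
have := ge0_integral_scale c0 (measurable_itv _) mF F0.
rewrite /gamma_cdf_moment => ->.
have -> : (fun x : R => c * x) @^-1` `]0, +oo[ = `]0, +oo[%classic.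
  by apply/seteqP; split => x /=; rewrite !in_itv/= !andbT pmulr_rgt0.
rewrite -(mulr_powRB1 (ltW c0) q0) EFinM -muleA; congr (_ * _)%E.
have G0 (v : R) : `]0, +oo[%classic v ->
    (0 <= (v `^ (q - 1))%:E * gamma_cdf (c * v) z)%E.
  rewrite /= in_itv/= andbT => v0.
  apply: mule_ge0; first by rewrite lee_fin powR_ge0.
  by apply: gamma_cdf_ge0; rewrite mulr_gt0.
have cq0 : (0 <= (c `^ (q - 1))%:E)%E by rewrite lee_fin powR_ge0.
rewrite -(ge0_integralZl lebesgue_measure (measurable_itv _)
  (measurable_gamma_cdf_scaled q z c0) G0 cq0).
apply: eq_integral => v; rewrite inE/= in_itv/= andbT => v0.
by rewrite [RHS]muleA -EFinM -(powRM _ (ltW c0) (ltW v0)).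
Qed.

Lemma integrable_gamma_dominating (R : realType) (q : R) : 0 < q ->
  (@lebesgue_measure R).-integrable `]0, +oo[
    (fun v : R => (v `^ (q - 1) * (expR 1 * expR (- (ln 2 * v))))%:E).
Proof.
move=> q0; have l2 : 0 < ln 2 :> R by rewrite ln_gt0// ltr1n.
have G := integral_Gamma_scale q0 l2.
have mf : measurable_fun (`]0, +oo[ : set R)
    (fun v : R => v `^ (q - 1) * expR (- (ln 2 * v))).
  exact: measurable_powR_expRNM.
have f0 (v : R) : 0 <= v `^ (q - 1) * expR (- (ln 2 * v)).
  by rewrite mulr_ge0 ?powR_ge0 ?expR_ge0.
have I : (@lebesgue_measure R).-integrable `]0, +oo[
    (fun v : R => (v `^ (q - 1) * expR (- (ln 2 * v)))%:E).
  apply/integrableP; split; first by apply/measurable_EFinP.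
  under eq_integral do rewrite gee0_abs ?lee_fin ?f0//.
  by rewrite G ltry.
have mD : measurable (`]0, +oo[%classic : set (measurableTypeR R)).
  exact: measurable_itv.
have -> : (fun v : R => (v `^ (q - 1) * (expR 1 * expR (- (ln 2 * v))))%:E) =
    (fun v => (expR 1)%:E * (v `^ (q - 1) * expR (- (ln 2 * v)))%:E)%E.
  by apply/funext => v; rewrite -EFinM mulrCA.
exact: integrableZl.
Qed.

Lemma gamma_cdf_dominated (R : realType) (q v z : R) : 0 < v -> 1 <= z ->
  ((v `^ (q - 1))%:E * gamma_cdf (z * v) z <=
   (v `^ (q - 1) * (expR 1 * expR (- (ln 2 * v))))%:E)%E.
Proof.
move=> v0 z1; have zv : 0 < z * v by rewrite mulr_gt0// (lt_le_trans _ z1).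
rewrite EFinM; apply: lee_pmul; [by rewrite lee_fin powR_ge0|exact: gamma_cdf_ge0|by []|].
exact: gamma_cdf_scaled_le.
Qed.

Lemma gamma_cdf_scaled_moment_fin_num (R : realType) (q z : R) : 0 < q -> 1 <= z ->
  gamma_cdf_scaled_moment q z \is a fin_num.
Proof.
move=> q0 z1; have z0 : 0 < z by exact: lt_le_trans z1.
have F0 (v : R) : `]0, +oo[%classic v ->
    (0 <= (v `^ (q - 1))%:E * gamma_cdf (z * v) z)%E.
  rewrite /= in_itv/= andbT => v0.
  apply: mule_ge0; first by rewrite lee_fin powR_ge0.
  by apply: gamma_cdf_ge0; rewrite mulr_gt0.
have mD : measurable (`]0, +oo[%classic : set (measurableTypeR R)).
  exact: measurable_itv.
have /integrableP[mg Ig] := integrable_gamma_dominating q0.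
rewrite ge0_fin_numE; last exact: integral_ge0.
apply: le_lt_trans Ig; apply: ge0_le_integral => //.
- exact: measurable_gamma_cdf_scaled.
- by apply: measurableT_comp mg.
- move=> v; rewrite /= in_itv/= andbT => v0.
  apply: le_trans (gamma_cdf_dominated q v0 z1) _.
  exact: lee_abs.
Qed.

Lemma cvgn_gamma_cdf_scaled_moment (R : realType) (q : R) (u : R^nat) :
  0 < q -> (forall n, 1 <= u n) -> u n @[n --> \oo] --> +oo ->
  gamma_cdf_scaled_moment q (u n) @[n --> \oo] --> (q^-1)%:E.
Proof.
move=> q0 u1 uy.
have u0 n : 0 < u n by exact: lt_le_trans (u1 n).
pose f n (v : R) : \bar R := ((v `^ (q - 1))%:E * gamma_cdf (u n * v) (u n))%E.
pose g (v : R) : \bar R := ((v `^ (q - 1))%:E * (if (v < 1)%R then 1 else 0))%E.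
have gE : g = (fun v : R => (v `^ (q - 1))%:E) \_ `]-oo, 1[.
  apply/funext => v; rewrite /g patchE; case: ifPn => v1.
    by rewrite mule1 ifT// inE/= in_itv.
  by rewrite mule0 ifF//; apply/negbTE; rewrite notin_setE/= in_itv/=; exact/negP.
have mf n : measurable_fun (`]0, +oo[ : set R) (f n).
  exact: measurable_gamma_cdf_scaled.
have mg : measurable_fun (`]0, +oo[ : set R) g.
  apply: measurable_funS measurableT (@subsetT _ _) _; rewrite gE.
  apply: (iffLR (measurable_restrictT _ _)) => //.
  apply: measurable_funS measurableT (@subsetT _ _) _.
  by apply/measurable_EFinP; exact: measurable_powR.
have mD : measurable (`]0, +oo[%classic : set (measurableTypeR R)).
  exact: measurable_itv.
have ae1 : {ae (@lebesgue_measure R), forall v, `]0, +oo[%classic v ->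
    f n v @[n --> \oo] --> g v}.
  exists [set 1]; split; [exact: measurable_set1|exact: lebesgue_measure_set1|].
  move=> v /= h; apply: contrapT => /eqP v1; apply: h.
  rewrite in_itv/= andbT => v0; rewrite /f /g.
  apply: cvgeZl => //; exact: cvg_gamma_cdf_scaled.
have ae2 : {ae (@lebesgue_measure R), forall v, forall n, `]0, +oo[%classic v ->
    (`|f n v| <= (v `^ (q - 1) * (expR 1 * expR (- (ln 2 * v))))%:E)%E}.
  apply: aeW => v n; rewrite /= in_itv/= andbT => v0.
  have uv : 0 < u n * v by rewrite mulr_gt0.
  rewrite gee0_abs; last first.
    by apply: mule_ge0; [rewrite lee_fin powR_ge0|exact: gamma_cdf_ge0].
  exact: gamma_cdf_dominated.
have [_ _] := dominated_convergence mD mf mg ae1 (integrable_gamma_dominating q0) ae2.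
have -> : (\int[lebesgue_measure]_(v in `]0%R, +oo[) g v = (q^-1)%:E)%E.
  rewrite gE -integral_mkcondr.
  have -> : `]0, +oo[ `&` `]-oo, 1[ = (`]0, 1[%classic : set R).
    apply/seteqP; split => v /=; rewrite !in_itv/= andbT.
      by move=> [-> ->].
    by move=> /andP[].
  have mp1 : measurable_fun (`]0, 1[%classic : set R)
      (fun v : R => (q * v `^ (q - 1))%:E).
    apply/measurable_EFinP; apply: measurable_funM => //.
    exact: measurable_powR_in.
  have qp0 (v : R) : `]0, 1[%classic v -> (0 <= (q * v `^ (q - 1))%:E)%E.
    by move=> _; rewrite lee_fin mulr_ge0 ?powR_ge0// ltW.
  have qi0 : (0 <= (q^-1)%:E)%E by rewrite lee_fin invr_ge0 ltW.
  transitivity (\int[lebesgue_measure]_(v in `]0%R, 1%R[)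
      ((q^-1)%:E * (q * v `^ (q - 1))%:E))%E.
    apply: eq_integral => v _; rewrite -EFinM mulrA mulVf ?mul1r//.
    by rewrite gt_eqF.
  rewrite (ge0_integralZl lebesgue_measure (measurable_itv _) mp1 qp0 qi0).
  by rewrite integral_powRB1// powR1 mule1.
by [].
Qed.

Lemma cvg_gamma_cdf_moment (R : realType) (q : R) : 0 < q ->
  (gamma_cdf_moment q z * ((z `^ q)^-1)%:E)%E @[z --> +oo] --> (q^-1)%:E.
Proof.
move=> q0.
have H : gamma_cdf_scaled_moment q z @[z --> +oo] --> (q^-1)%:E.
  apply: cvg_EFin.
    apply: filterS (nbhs_pinfty_ge (num_real 1)) => z z1.
    exact: gamma_cdf_scaled_moment_fin_num.
  apply/cvg_pinftyP => u uy.
  pose v n := Num.max 1 (u n).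
  have v1 n : 1 <= v n by rewrite /v le_max lexx.
  have vy : v n @[n --> \oo] --> +oo.
    apply/cvgryPge => A; have /cvgryPge /(_ A) := uy.
    by apply: filterS => n h; rewrite /v le_max h orbT.
  have := cvgn_gamma_cdf_scaled_moment q0 v1 vy.
  move=> /fine_cvg /=; apply: cvg_trans; apply: near_eq_cvg.
  have /cvgryPge /(_ 1) := uy; apply: filterS => n h.
  by rewrite /= /v max_r.
apply: cvg_trans H; apply: near_eq_cvg.
near=> z; have z0 : 0 < z by near: z; exact: nbhs_pinfty_gt.
rewrite (gamma_cdf_moment_scale z q0 z0) -/(gamma_cdf_scaled_moment q z).
rewrite muleC muleA -EFinM mulVf ?mul1e//.
by rewrite gt_eqF// powR_gt0.
Unshelve. all: by end_near. Qed.

(** * The Hausdorff moment problem *)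

(* (bernstein n g).[x] is the expectation of g at the number of successes in n
   Bernoulli(x) trials; the recursion conditions on the first trial. *)
Fixpoint bernstein (R : comNzRingType) (n : nat) (g : nat -> R) : {poly R} :=
  if n is n'.+1 then
    'X * bernstein n' (g \o succn) + (1 - 'X) * bernstein n' g
  else (g 0%N)%:P.

Lemma bernstein_approx (R : realFieldType) (n : nat) (g : nat -> R)
    (x y A B c : R) :
  0 <= x <= 1 -> (forall k, `|g k - y| <= A + B * (k%:R - c) ^+ 2) ->
  `|(bernstein n g).[x] - y| <=
    A + B * (n%:R * x * (1 - x) + (n%:R * x - c) ^+ 2).
Proof.
move=> /andP[x0 x1]; elim: n g c => [|n IH] g c gk /=.
  by rewrite hornerC !mul0r add0r.
rewrite !(hornerE, horner_comp).
set p := (bernstein n (g \o succn)).[x]; set r := (bernstein n g).[x].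
have Hp : `|p - y| <= A + B * (n%:R * x * (1 - x) + (n%:R * x - (c - 1)) ^+ 2).
  apply: IH => k; apply: le_trans (gk k.+1) _.
  by rewrite -natr1 opprB addrA addrAC lexx.
have Hr : `|r - y| <= A + B * (n%:R * x * (1 - x) + (n%:R * x - c) ^+ 2).
  exact: IH.
have -> : x * p + (1 - x) * r - y = x * (p - y) + (1 - x) * (r - y) by ring.
apply: le_trans (ler_normD _ _) _.
rewrite !normrM (ger0_norm x0) [`|1 - x|]ger0_norm ?subr_ge0//.
apply: (@le_trans _ _ (x * (A + B * (n%:R * x * (1 - x) + (n%:R * x - (c - 1)) ^+ 2)) +
  (1 - x) * (A + B * (n%:R * x * (1 - x) + (n%:R * x - c) ^+ 2)))).
  by rewrite lerD// ler_wpM2l// subr_ge0.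
rewrite -natr1 le_eqVlt; apply/orP; left; apply/eqP; ring.
Qed.

Lemma lipschitz_poly_approx (R : realType) (f : R -> R) (K e : R) :
  0 < e -> (forall x y, `|f x - f y| <= K * `|x - y|) ->
  exists p : {poly R}, forall x, 0 <= x <= 1 -> `|p.[x] - f x| <= e.
Proof.
move=> e0 fK.
have K0 : 0 <= K.
  have := fK 1 0; rewrite subr0 normr1 mulr1; apply: le_trans; exact: normr_ge0.
pose e1 := e / (2 * (K + 1)).
have K1 : 0 < K + 1 by rewrite ltr_wpDl.
have e10 : 0 < e1 by rewrite divr_gt0// mulr_gt0.
pose n := (Num.truncn (e1 ^- 2)).+1.
have n0 : (0 : R) < n%:R by rewrite ltr0n.
have ne : (e1 ^+ 2)^-1 < n%:R by exact: truncnS_gt.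
exists (bernstein n (fun k => f (k%:R / n%:R))) => x x01.
have /andP[x0 x1] := x01.
have H k : `|f (k%:R / n%:R) - f x| <=
    K * e1 + K / (e1 * n%:R ^+ 2) * (k%:R - n%:R * x) ^+ 2.
  apply: le_trans (fK _ _) _.
  set u := k%:R - n%:R * x.
  have -> : k%:R / n%:R - x = u / n%:R by rewrite /u; field; rewrite gt_eqF.
  rewrite -mulrA -mulrDr ler_wpM2l//.
  rewrite normrM [`|n%:R^-1|]gtr0_norm ?invr_gt0//.
  have -> : (e1 * n%:R ^+ 2)^-1 * u ^+ 2 = (`|u| / n%:R) ^+ 2 / e1.
    rewrite -(real_normK (num_real u)); field.
    by rewrite !gt_eqF.
  move: (`|u| / n%:R) => v.
  have -> : e1 + v ^+ 2 / e1 = v + (e1 - v / 2) ^+ 2 / e1 + 3 / 4 * (v ^+ 2 / e1).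
    by field; rewrite gt_eqF.
  have h5 : 0 <= e1^-1 by rewrite invr_ge0 ltW.
  have h6 w : 0 <= w ^+ 2 / e1 by rewrite mulr_ge0// sqr_ge0.
  by rewrite -addrA lerDl addr_ge0// mulr_ge0.
apply: le_trans (bernstein_approx n x01 H) _.
rewrite subrr expr0n/= addr0.
have -> : K / (e1 * n%:R ^+ 2) * (n%:R * x * (1 - x)) =
    K * (x * (1 - x)) * (e1 * n%:R)^-1.
  by field; rewrite !gt_eqF.
have h1 : (e1 * n%:R)^-1 <= e1.
  have en0 : 0 < e1 * n%:R by exact: mulr_gt0.
  rewrite -[leLHS]mul1r ler_pdivrMr//.
  have e20 : 0 < e1 ^+ 2 by exact: exprn_gt0.
  move: ne; rewrite -(ltr_pM2r e20) mulVf ?(gt_eqF e20)// => /ltW.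
  by have -> : n%:R * e1 ^+ 2 = e1 * (e1 * n%:R) by ring.
have h2 : x * (1 - x) <= 1 by nra.
have h3 : 0 <= x * (1 - x) by rewrite mulr_ge0// subr_ge0.
have h4 : K * (x * (1 - x)) * (e1 * n%:R)^-1 <= K * e1.
  rewrite -mulrA ler_wpM2l// -[leRHS]mul1r ler_pM//.
  by rewrite invr_ge0 mulr_ge0 ?ltW.
apply: (@le_trans _ _ (K * e1 + K * e1)); first by rewrite lerD2l.
have -> : K * e1 + K * e1 = K / (K + 1) * e by rewrite /e1; field; rewrite gt_eqF.
rewrite ler_piMl ?(ltW e0)// ler_pdivrMr// mul1r lerDl//.
Qed.

Definition unit_weight (d : measure_display) (T : measurableType d)
    (R : realType) (m : {measure set T -> \bar R}) (D : set T) (w X : T -> R) :=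
  [/\ measurable D, m.-integrable D (EFin \o w), measurable_fun D X &
    forall x, D x -> 0 <= w x /\ 0 <= X x <= 1].

Lemma integrable_unit_weight (d : measure_display) (T : measurableType d)
    (R : realType) (m : {measure set T -> \bar R}) (D : set T) (w X : T -> R)
    (f : R -> R) (C : R) :
  unit_weight m D w X -> measurable_fun setT f ->
  (forall x, 0 <= x <= 1 -> `|f x| <= C) ->
  m.-integrable D (fun x => (w x * f (X x))%:E).
Proof.
move=> [mD iw mX wX] mf fC.
have /integrableP[mw _] := iw.
apply: (le_integrable mD _ _ (integrableZl mD C iw)).
  apply/measurable_EFinP; apply: measurable_funM; first exact/measurable_EFinP.
  exact: measurableT_comp.
move=> x Dx; have [w0 X01] := wX x Dx.
rewrite /= lee_fin normrM (ger0_norm w0) mulrC.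
have C0 : 0 <= C by exact: le_trans (fC _ X01).
rewrite normrM (ger0_norm w0) (ger0_norm C0).
by rewrite ler_wpM2r// fC.
Qed.

Lemma integrable_unit_weight_poly (d : measure_display) (T : measurableType d)
    (R : realType) (m : {measure set T -> \bar R}) (D : set T) (w X : T -> R)
    (p : {poly R}) (n : nat) :
  unit_weight m D w X ->
  m.-integrable D (fun x => (w x * (X x ^+ n * p.[X x]))%:E).
Proof.
move=> U; have [mD iw mX wX] := U.
elim/poly_ind: p n => [|p c IH] n.
  rewrite (_ : (fun _ => _) = cst 0%E); first exact: integrable0.
  by apply/funext => x; rewrite horner0 !mulr0.
have Hn : m.-integrable D (fun x => (w x * (X x) ^+ n)%:E).
  apply: (@integrable_unit_weight _ _ _ _ _ _ _ (fun x => x ^+ n) 1) => //.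
  move=> x /andP[x0 x1]; rewrite normrX ger0_norm//.
  exact: exprn_ile1.
have := integrableD mD (IH n.+1) (integrableZl mD c Hn).
congr (_.-integrable _ _); apply/funext => x /=.
transitivity (w x * (X x ^+ n.+1 * p.[X x]) + c * (w x * X x ^+ n))%:E => //.
by congr EFin; rewrite hornerD hornerMX hornerC exprSr; ring.
Qed.

Lemma Rintegral_unit_weight_poly (d1 d2 : measure_display)
    (T1 : measurableType d1) (T2 : measurableType d2) (R : realType)
    (m1 : {measure set T1 -> \bar R}) (m2 : {measure set T2 -> \bar R})
    (D1 : set T1) (D2 : set T2) (w1 X1 : T1 -> R) (w2 X2 : T2 -> R)
    (p : {poly R}) (n : nat) :
  unit_weight m1 D1 w1 X1 -> unit_weight m2 D2 w2 X2 ->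
  (forall k, \int[m1]_(x in D1) (w1 x * X1 x ^+ k) =
             \int[m2]_(x in D2) (w2 x * X2 x ^+ k)) ->
  \int[m1]_(x in D1) (w1 x * (X1 x ^+ n * p.[X1 x])) =
  \int[m2]_(x in D2) (w2 x * (X2 x ^+ n * p.[X2 x])).
Proof.
move=> U1 U2 M; elim/poly_ind: p n => [|p c IH] n.
  under eq_Rintegral do rewrite horner0 !mulr0.
  under [RHS]eq_Rintegral do rewrite horner0 !mulr0.
  by rewrite /Rintegral !integral0.
have E (d : measure_display) (T : measurableType d)
    (m : {measure set T -> \bar R}) (D : set T) (w X : T -> R) :
    unit_weight m D w X ->
    \int[m]_(x in D) (w x * (X x ^+ n * (p * 'X + c%:P).[X x])) =
    \int[m]_(x in D) (w x * (X x ^+ n.+1 * p.[X x])) +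
    c * \int[m]_(x in D) (w x * X x ^+ n).
  move=> U; have [mD _ _ _] := U.
  have I1 := integrable_unit_weight_poly p n.+1 U.
  have I2 : m.-integrable D (fun x => (w x * X x ^+ n)%:E).
    have := integrable_unit_weight_poly 1 n U.
    by congr (_.-integrable _ _); apply/funext => x; rewrite hornerC mulr1.
  rewrite -RintegralZl// -RintegralD//; last first.
    by have := integrableZl mD c I2; congr (_.-integrable _ _).
  by apply: eq_Rintegral => x _; rewrite hornerD hornerMX hornerC exprSr; ring.
by rewrite !E// IH M.
Qed.

Lemma Rintegral_unit_weight_lipschitz (d1 d2 : measure_display)
    (T1 : measurableType d1) (T2 : measurableType d2) (R : realType)
    (m1 : {measure set T1 -> \bar R}) (m2 : {measure set T2 -> \bar R})
    (D1 : set T1) (D2 : set T2) (w1 X1 : T1 -> R) (w2 X2 : T2 -> R)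
    (f : R -> R) (K : R) :
  unit_weight m1 D1 w1 X1 -> unit_weight m2 D2 w2 X2 ->
  (forall k, \int[m1]_(x in D1) (w1 x * X1 x ^+ k) =
             \int[m2]_(x in D2) (w2 x * X2 x ^+ k)) ->
  measurable_fun setT f ->
  (forall x y, `|f x - f y| <= K * `|x - y|) ->
  \int[m1]_(x in D1) (w1 x * f (X1 x)) = \int[m2]_(x in D2) (w2 x * f (X2 x)).
Proof.
move=> U1 U2 M mf fK.
have K0 : 0 <= K.
  have := fK 1 0; rewrite subr0 normr1 mulr1; apply: le_trans; exact: normr_ge0.
have fC x : 0 <= x <= 1 -> `|f x| <= `|f 0| + K.
  move=> /andP[x0 x1]; rewrite -[X in `|X|](subrK (f 0)) addrC.
  apply: le_trans (ler_normD _ _) _; rewrite lerD2l.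
  apply: le_trans (fK _ _) _; rewrite subr0 ger0_norm//.
  by rewrite ler_piMr.
have approx (d : measure_display) (T : measurableType d)
    (m : {measure set T -> \bar R}) (D : set T) (w X : T -> R) p e :
    unit_weight m D w X -> 0 < e ->
    (forall x, 0 <= x <= 1 -> `|p.[x] - f x| <= e) ->
    `|\int[m]_(x in D) (w x * p.[X x]) - \int[m]_(x in D) (w x * f (X x))| <=
    e * \int[m]_(x in D) w x.
  move=> U e0 pf; have [mD iw mX wX] := U.
  have Ip : m.-integrable D (fun x => (w x * p.[X x])%:E).
    have := integrable_unit_weight_poly p 0 U.
    by congr (_.-integrable _ _); apply/funext => x; rewrite expr0 mul1r.
  have If := integrable_unit_weight U mf fC.
  have Id : m.-integrable D (fun x => (w x * p.[X x] - w x * f (X x))%:E).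
    by have := integrableB mD Ip If; congr (_.-integrable _ _).
  rewrite -RintegralB// -RintegralZl//.
  apply: le_trans (le_normr_Rintegral mD Id) _.
  apply: le_Rintegral => //.
  - by have := integrable_abse Id; congr (_.-integrable _ _).
  - by have := integrableZl mD e iw; congr (_.-integrable _ _).
  - move=> x Dx; have [w0 X01] := wX x Dx.
    by rewrite -mulrBr normrM (ger0_norm w0) mulrC ler_wpM2r// pf.
apply/eqP; rewrite -subr_eq0 -normr_le0; apply/ler_addgt0Pr => e e0; rewrite add0r.
pose W := \int[m1]_(x in D1) w1 x + \int[m2]_(x in D2) w2 x.
have W0 : 0 <= W.
  by apply: addr_ge0; apply: Rintegral_ge0 => x Dx;
    [case: U1|case: U2] => _ _ _ /(_ x Dx)[].
have e1 : 0 < e / (W + 1) by rewrite divr_gt0// ltr_wpDl.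
have [p pf] := lipschitz_poly_approx e1 fK.
have A1 := approx _ _ _ _ _ _ p _ U1 e1 pf.
have A2 := approx _ _ _ _ _ _ p _ U2 e1 pf.
have := Rintegral_unit_weight_poly p 0 U1 U2 M.
under eq_Rintegral do rewrite expr0 mul1r.
under [RHS]eq_Rintegral do rewrite expr0 mul1r.
move=> Ep; rewrite Ep in A1.
move: A1 A2; set I2 := \int[m2]_(x in D2) (w2 x * p.[X2 x]) => A1 A2.
rewrite -[X in `|X - _|](subrK I2) -addrA.
apply: le_trans (ler_normD _ _) _.
rewrite -normrN opprB; apply: le_trans (lerD A1 A2) _.
rewrite -mulrDr -/W mulrAC ler_pdivrMr ?ltr_wpDl//.
by rewrite ler_wpM2l ?(ltW e0)// lerDl.
Qed.

Lemma clamp_lipschitz (R : realDomainType) (a b : R) :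
  `|Num.min 1 (Num.max 0 a) - Num.min 1 (Num.max 0 b)| <= `|a - b|.
Proof.
rewrite /Num.min /Num.max ler_norml.
have [ab|ba] := lerP 0 (a - b); [rewrite ger0_norm//|rewrite ltr0_norm//];
  case: ifPn; case: ifPn; case: ifPn; case: ifPn; rewrite -?leNgt; lra.
Qed.

(* The indicator of ]c, 1] is a pointwise limit of Lipschitz functions. *)
Lemma unit_weight_moments_unique (d1 d2 : measure_display)
    (T1 : measurableType d1) (T2 : measurableType d2) (R : realType)
    (m1 : {measure set T1 -> \bar R}) (m2 : {measure set T2 -> \bar R})
    (D1 : set T1) (D2 : set T2) (w1 X1 : T1 -> R) (w2 X2 : T2 -> R) (c : R) :
  unit_weight m1 D1 w1 X1 -> unit_weight m2 D2 w2 X2 ->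
  (forall k, \int[m1]_(x in D1) (w1 x * X1 x ^+ k) =
             \int[m2]_(x in D2) (w2 x * X2 x ^+ k)) ->
  (\int[m1]_(x in D1 `&` [set x | (c < X1 x)%R]) (w1 x)%:E =
   \int[m2]_(x in D2 `&` [set x | (c < X2 x)%R]) (w2 x)%:E)%E.
Proof.
move=> U1 U2 M.
pose f (k : nat) (x : R) : R := Num.min 1 (Num.max 0 (k%:R * (x - c))).
have f01 k x : 0 <= f k x <= 1.
  by rewrite /f le_min ler01 le_max lexx/= ge_min lexx.
have mf k : measurable_fun setT (f k).
  apply: measurable_minr => //; apply: measurable_maxr => //.
  by apply: measurable_funM => //; apply: measurable_funB.
have fC k x : 0 <= x <= 1 -> `|f k x| <= 1.
  by move=> _; have /andP[f0 f1] := f01 k x; rewrite ger0_norm.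
have C (d : measure_display) (T : measurableType d)
    (m : {measure set T -> \bar R}) (D : set T) (w X : T -> R) :
    unit_weight m D w X ->
    (\int[m]_(x in D) (w x * f k (X x)))%:E @[k --> \oo] -->
    (\int[m]_(x in D `&` [set x | (c < X x)%R]) (w x)%:E)%E.
  move=> U; have [mD iw mX wX] := U.
  under eq_fun => k.
    rewrite /Rintegral fineK; last first.
      exact: integrable_fin_num (integrable_unit_weight U (mf k) (fC k)).
    over.
  rewrite integral_mkcondr; 
  apply: (@dominated_cvg _ _ _ m D mD (fun k x => (w x * f k (X x))%:E) _
    (EFin \o w)) => //.
  - by move=> k; have /integrableP[] := integrable_unit_weight U (mf k) (fC k).
  - move=> x Dx; rewrite patchE; case: ifPn => [|].
      rewrite inE/= => cX; rewrite -[X in _ --> X%:E]mulr1.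
      apply: cvg_EFin; first exact: nearW.
      apply: cvgM; first exact: cvg_cst.
      apply: cvg_near_cst; near=> k; apply/eqP; rewrite /f.
      rewrite min_l// le_max; apply/orP; right.
      rewrite -ler_pdivrMr ?subr_gt0// mul1r ltW//; near: k.
      exact: nbhs_infty_gtr.
    rewrite notin_setE/= => /negP; rewrite -leNgt => Xc.
    rewrite (_ : (fun _ => _) = cst 0%E); first exact: cvg_cst.
    apply/funext => k; rewrite /f max_l ?mulr_ge0_le0 ?subr_le0//.
    by rewrite min_r// mulr0.
  - move=> k x Dx; have [w0 _] := wX x Dx; have /andP[f0 f1] := f01 k (X x).
    by rewrite /= lee_fin ger0_norm ?mulr_ge0// ler_piMr.
apply: (cvg_unique _ (C _ _ _ _ _ _ U1)) => //=.
have -> : (fun k => (\int[m1]_(x in D1) (w1 x * f k (X1 x)))%:E) =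
          (fun k => (\int[m2]_(x in D2) (w2 x * f k (X2 x)))%:E).
  apply/funext => k; congr EFin.
  apply: (Rintegral_unit_weight_lipschitz (K := k%:R) U1 U2 M (mf k)) => x y.
  apply: le_trans (clamp_lipschitz _ _) _.
  by rewrite -mulrBr opprB addrA subrK normrM normr_nat.
exact: C.
Unshelve. all: by end_near. Qed.

(** * The gamma subordinator and its inverse *)

Section ae_eq_integral_nonmeasurable.
Import HBNNSimple.

(* f is not assumed to be measurable: the inverse process is only almost
   everywhere equal to a measurable function. *)
Lemma ge0_ae_eq_integral_measurable (d : measure_display) (T : measurableType d)
    (R : realType) (m : {measure set T -> \bar R}) (f g : T -> \bar R) :
  (forall x, (0 <= f x)%E) -> (forall x, (0 <= g x)%E) ->
  measurable_fun setT g -> {ae m, forall x, f x = g x} ->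
  (\int[m]_x f x = \int[m]_x g x)%E.
Proof.
move=> f0 g0 mg [N [mN N0 fgN]].
apply/eqP; rewrite eq_le; apply/andP; split.
  rewrite [leLHS]ge0_integralTE//; apply: ge_ereal_sup => _ [h hf <-].
  rewrite -integralT_nnsfun; apply: ae_ge0_le_integral => //.
  - by move=> x _; rewrite lee_fin.
  - exact/measurable_EFinP.
  - exists N; split => // x /= hx; apply: fgN => /= fg; apply: hx => _.
    by rewrite -fg; exact: hf.
have mNC : measurable (~` N) by exact: measurableC.
have mgN : measurable_fun setT (g \_ (~` N)).
  apply: (iffLR (measurable_restrictT _ _)) => //.
  exact: measurable_funS mg.
have gN0 x : (0 <= (g \_ (~` N)) x)%E by apply: erestrict_ge0.
have -> : (\int[m]_x g x = \int[m]_x (g \_ (~` N)) x)%E.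
  apply: ge0_ae_eq_integral => //.
  exists N; split => // x /= hx; apply: contrapT => Nx; apply: hx => _.
  by rewrite patchE ifT// inE.
rewrite !ge0_integralTE//; apply: ge_ereal_sup => _ [h hg <-].
apply: ereal_sup_ubound; exists h => // x; apply: le_trans (hg x) _.
rewrite patchE; case: ifPn => //.
rewrite inE => Nx; have -> // : f x = g x.
by apply: contrapT => fg; exact: Nx (fgN x fg).
Qed.

End ae_eq_integral_nonmeasurable.

Lemma subordinator_ge0 (d : measure_display) (T : measurableType d)
    (R : realType) (P : probability T R) (H : R -> {RV P >-> R}) (s : R) :
  subordinator H -> 0 <= s -> {ae P, forall w, 0 <= H s w}.
Proof.
move=> [LH mono] s0; have := levy_start LH; move: mono.
apply: filterS2 => w mono H0; rewrite -H0; exact: mono.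
Qed.

Lemma measurable_lt_RV (d : measure_display) (T : measurableType d)
    (R : realType) (P : probability T R) (X : {RV P >-> R}) (t : R) :
  measurable [set w | X w < t].
Proof.
have := measurable_funP X measurableT _ (measurable_itv `]-oo, t[).
by rewrite setTI (_ : X @^-1` _ = [set w | X w < t]).
Qed.

Lemma gamma_subordinator_law (d : measure_display) (T : measurableType d)
    (R : realType) (P : probability T R) (a b : R) (H : R -> {RV P >-> R})
    (s t : R) :
  0 < a -> 0 < b -> gamma_subordinator a b H -> 0 < s -> 0 < t ->
  P [set w | H s w < t] = gamma_cdf (a * s) (b * t).
Proof.
move=> a0 b0 [SH lap] s0 t0.
have y0 : 0 < a * s by rewrite mulr_gt0.
have G0 := Gamma_gt0 y0.
pose X1 (w : T) : R := expR (- (b * Num.max 0 (H s w))).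
pose X2 (u : R) : R := expR (- u).
pose w2 (u : R) : R := (Gamma (a * s))^-1 * (u `^ (a * s - 1) * expR (- u)).
have mX1 : measurable_fun setT X1.
  apply: measurableT_comp; first exact: measurable_expR.
  apply: measurableT_comp; first exact: oppr_measurable.
  by apply: measurable_funM => //; apply: measurable_maxr.
have U1 : unit_weight P setT (cst 1) X1.
  split => //.
    exact: finite_measure_integrable_cst.
  move=> w _; split => //; rewrite /X1 expR_ge0 expR_le1 oppr_le0.
  by rewrite mulr_ge0 ?(ltW b0)// le_max lexx.
have mD : measurable (`]0, +oo[%classic : set (measurableTypeR R)).
  exact: measurable_itv.
have mw2 : measurable_fun (`]0, +oo[%classic : set R) w2.
  by apply: measurable_funM => //; exact: measurable_powR_expRN.
have w20 u : 0 <= w2 u.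
  by rewrite /w2 !mulr_ge0 ?powR_ge0 ?expR_ge0// invr_ge0 ltW.
have Iw2 (k : nat) : (\int[lebesgue_measure]_(u in `]0%R, +oo[) (w2 u * X2 u ^+ k)%:E =
    ((1 + k%:R) `^ (- (a * s)))%:E)%E.
  have k0 : 0 < 1 + k%:R :> R by rewrite ltr_wpDr.
  transitivity (\int[lebesgue_measure]_(u in `]0%R, +oo[)
     ((Gamma (a * s))^-1%:E * (u `^ (a * s - 1) * expR (- ((1 + k%:R) * u)))%:E))%E.
    apply: eq_integral => u _; rewrite -EFinM; congr EFin.
    rewrite /w2 /X2 -expRM_natl -!mulrA -expRD; congr (_ * (_ * expR _)).
    by ring.
  have mk : measurable_fun (`]0, +oo[ : set R)
      (fun u : R => (u `^ (a * s - 1) * expR (- ((1 + k%:R) * u)))%:E).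
    by apply/measurable_EFinP; exact: measurable_powR_expRNM.
  have k0u (u : R) : `]0, +oo[%classic u ->
      (0 <= (u `^ (a * s - 1) * expR (- ((1 + k%:R) * u)))%:E)%E.
    by move=> _; rewrite lee_fin mulr_ge0 ?powR_ge0 ?expR_ge0.
  have Gi0 : (0 <= ((Gamma (a * s))^-1)%:E)%E by rewrite lee_fin invr_ge0 ltW.
  rewrite (ge0_integralZl lebesgue_measure mD mk k0u Gi0).
  rewrite (integral_Gamma_scale y0 k0) -EFinM mulrCA mulVf ?mulr1//.
  by rewrite (gt_eqF G0).
have U2 : unit_weight lebesgue_measure `]0, +oo[%classic w2 X2.
  split => //.
  - apply/integrableP; split; first exact/measurable_EFinP.
    under eq_integral => u _.
      rewrite /= ger0_norm// -[w2 u]mulr1 -(expr0 (X2 u)); over.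
    by rewrite Iw2 ltry.
  - apply: measurable_funS measurableT (@subsetT _ _) _.
    by apply: measurableT_comp; [exact: measurable_expR|exact: oppr_measurable].
  - move=> u; rewrite /= in_itv/= andbT => u0; split => //.
    by rewrite /X2 expR_ge0 expR_le1 oppr_le0 ltW.
have M k : \int[P]_(w in setT) (cst 1 w * X1 w ^+ k) =
    \int[lebesgue_measure]_(u in `]0, +oo[) (w2 u * X2 u ^+ k).
  rewrite /Rintegral Iw2; congr fine.
  have := lap s (b * k%:R) (ltW s0) (mulr_ge0 (ltW b0) (ler0n _ k)).
  rewrite unlock => lapk.
  transitivity (\int[P]_w (expR (- (b * k%:R) * H s w))%:E)%E.
    apply: ge0_ae_eq_integral => //.
    - by apply/measurable_EFinP; apply: measurable_funM => //; exact: measurable_funX.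
    - apply/measurable_EFinP; apply: measurableT_comp; first exact: measurable_expR.
      exact: measurable_funM.
    - by move=> w _; rewrite lee_fin mul1r exprn_ge0// expR_ge0.
    - have := subordinator_ge0 SH (ltW s0); apply: filterS => w H0 _.
      by rewrite /= mul1r /X1 max_r// -expRM_natl; congr (expR _)%:E; ring.
  rewrite lapk; congr EFin; rewrite /gamma_exponent mulrAC divff ?gt_eqF// mul1r.
  rewrite /powR gt_eqF; last by rewrite ltr_wpDr.
  by congr expR; ring.
have := unit_weight_moments_unique (expR (- (b * t))) U1 U2 M.
have -> : setT `&` [set w | expR (- (b * t)) < X1 w] = [set w | H s w < t].
  rewrite setTI; apply/seteqP; split => w /=;
    by rewrite /X1 ltr_expR ltrN2 ltr_pM2l// gt_max t0.
have -> : `]0, +oo[ `&` [set u | expR (- (b * t)) < X2 u] = `]0, b * t[%classic.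
  apply/seteqP; split => u /=; rewrite !in_itv/= andbT /X2 ltr_expR ltrN2.
    by move=> [-> ->].
  by move=> /andP[-> ->].
have -> : (\int[P]_(w in [set w | (H s w < t)%R]) (cst 1%R w)%:E =
    P [set w | (H s w < t)%R])%E.
  by rewrite -[RHS]mul1e -(integral_cst P (measurable_lt_RV (H s) t)).
move=> ->.
have mk : measurable_fun (`]0, b * t[%classic : set R)
    (fun u : R => (u `^ (a * s - 1) * expR (- u))%:E).
  by apply/measurable_EFinP; exact: measurable_powR_expRN.
have k0 (u : R) : `]0, b * t[%classic u -> (0 <= (u `^ (a * s - 1) * expR (- u))%:E)%E.
  by move=> _; rewrite lee_fin mulr_ge0 ?powR_ge0 ?expR_ge0.
have Gi0 : (0 <= ((Gamma (a * s))^-1)%:E)%E by rewrite lee_fin invr_ge0 ltW.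
rewrite gamma_cdfE /lower_gamma.
rewrite -(ge0_integralZl lebesgue_measure (measurable_itv _) mk k0 Gi0).
by apply: eq_integral => u _; rewrite -EFinM.
Qed.

Lemma gamma_subordinator_gt0 (d : measure_display) (T : measurableType d)
    (R : realType) (P : probability T R) (a b : R) (H : R -> {RV P >-> R})
    (s : R) :
  0 < a -> 0 < b -> gamma_subordinator a b H -> 0 < s ->
  {ae P, forall w, 0 < H s w}.
Proof.
move=> a0 b0 HH s0; have y0 : 0 < a * s by rewrite mulr_gt0.
have y1 : 0 < Gamma (a * s + 1) by apply: Gamma_gt0; rewrite addr_gt0.
pose N := [set w | H s w <= 0].
have mN : measurable N.
  have := measurable_funP (H s) measurableT _ (measurable_itv `]-oo, 0]).
  by rewrite setTI (_ : (H s) @^-1` _ = N).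
exists N; split => //; last by move=> w /= /negP; rewrite -leNgt.
apply/eqP; rewrite eq_le measure_ge0 andbT.
apply/lee_addgt0Pr => e e0; rewrite add0e.
pose z := (e * Gamma (a * s + 1)) `^ (a * s)^-1.
have eG : 0 < e * Gamma (a * s + 1) by exact: mulr_gt0.
have z0 : 0 < z by exact: powR_gt0.
have t0 : 0 < z / b by exact: divr_gt0.
apply: (@le_trans _ _ (P [set w | H s w < z / b])).
  apply: le_measure; rewrite ?inE//; first exact: measurable_lt_RV.
  by move=> w /= /le_lt_trans; exact.
rewrite (gamma_subordinator_law a0 b0 HH s0 t0) mulrCA divff ?gt_eqF// mulr1.
apply: le_trans (gamma_cdf_le y0 z0) _.
rewrite lee_fin /z -powRrM mulVf ?gt_eqF// powRr1 ?(ltW eG)//.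
by rewrite mulfK ?gt_eqF.
Qed.

Lemma lt_inverse_process (d : measure_display) (T : measurableType d)
    (R : realType) (P : probability T R) (H : R -> {RV P >-> R}) (s t : R)
    (w : T) :
  cadlag (fun u => H u w) ->
  (forall u v, 0 <= u -> u <= v -> H u w <= H v w) ->
  (forall u, 0 < u -> 0 < H u w) -> 0 < s ->
  (s%:E < inverse_process H t w)%E = (H s w < t).
Proof.
move=> [rc _] mono pos s0; apply/idP/idP.
  apply: contraTT; rewrite -!leNgt => tH; apply: ereal_inf_lbound.
  exists s => //; split => // /andP[_].
  by rewrite ltNge tH.
move=> Hst.
have H1 : \forall r \near s^'+, H r w < t by exact: cvgr_lt (rc s (ltW s0)) _ Hst.
have [r [rt sr]] : exists r, H r w < t /\ s < r.
  apply: (@filter_ex _ (s^'+)); near=> r; split; near: r => //.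
  exact: nbhs_right_gt.
apply: (@lt_le_trans _ _ r%:E); first by rewrite lte_fin.
apply: le_ereal_inf_tmp => _ [u [u0 nu] <-]; rewrite lee_fin leNgt.
apply/negP => ur; apply: nu; rewrite pos//=.
by apply: le_lt_trans rt; apply: mono; exact: ltW.
Unshelve. all: by end_near. Qed.

Definition rational_passage (d : measure_display) (T : measurableType d)
    (R : realType) (P : probability T R) (H : R -> {RV P >-> R})
    (t : R) (n : nat) (w : T) : \bar R :=
  let r : R := ratr (odflt 0 (unpickle n)) in
  if (0 < r) && (H r w < t) then r%:E else 0%E.

(* A measurable version of the inverse process. *)
Definition passage (d : measure_display) (T : measurableType d)
    (R : realType) (P : probability T R) (H : R -> {RV P >-> R})
    (t : R) (w : T) : \bar R :=
  esups (fun n => rational_passage H t n w) 0%N.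

Lemma measurable_passage (d : measure_display) (T : measurableType d)
    (R : realType) (P : probability T R) (H : R -> {RV P >-> R}) (t : R) :
  measurable_fun setT (passage H t).
Proof.
apply: (@measurable_fun_esups _ _ _ _ (rational_passage H t)) => n.
rewrite /rational_passage; set r : R := ratr _.
have [r0|r0] := ltP 0 r => //=.
apply: measurable_fun_ifT => //.
apply: (measurable_fun_bool true); rewrite setTI.
exact: measurable_lt_RV.
Qed.

Lemma passage_ge0 (d : measure_display) (T : measurableType d)
    (R : realType) (P : probability T R) (H : R -> {RV P >-> R}) (t : R) (w : T) :
  (0 <= passage H t w)%E.
Proof.
apply: (@le_trans _ _ (rational_passage H t 0 w)).
  rewrite /rational_passage; case: ifPn => // /andP[r0 _].
  by rewrite lee_fin ltW.
by apply: ereal_sup_ubound; exists 0%N.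
Qed.

Lemma inverse_process_ge0 (d : measure_display) (T : measurableType d)
    (R : realType) (P : probability T R) (H : R -> {RV P >-> R}) (t : R) (w : T) :
  (0 <= inverse_process H t w)%E.
Proof. by apply: le_ereal_inf_tmp => _ [u [u0 _] <-]; rewrite lee_fin ltW. Qed.

Lemma inverse_process_passage (d : measure_display) (T : measurableType d)
    (R : realType) (P : probability T R) (H : R -> {RV P >-> R}) (t : R)
    (w : T) :
  cadlag (fun u => H u w) ->
  (forall u v, 0 <= u -> u <= v -> H u w <= H v w) ->
  (forall u, 0 < u -> 0 < H u w) ->
  inverse_process H t w = passage H t w.
Proof.
move=> rc mono pos; apply/eqP; rewrite eq_le; apply/andP; split; last first.
  rewrite /passage; apply: ge_ereal_sup => _ [n _ <-]; rewrite /rational_passage.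
  case: ifPn => [/andP[r0]|_]; last exact: inverse_process_ge0.
  by rewrite -(lt_inverse_process t rc mono pos r0) => /ltW.
rewrite leNgt; apply/negP => XL.
have X0 := passage_ge0 H t w.
have [r Xr rL] : exists2 r : rat,
    (passage H t w < (ratr r : R)%:E)%E &
    ((ratr r : R)%:E < inverse_process H t w)%E.
  move: XL X0; case: (passage H t w) => [x||]//.
  - case: (inverse_process H t w) => [l||]// + _.
    + rewrite lte_fin => /rat_in_itvoo[r]; rewrite in_itv/= => /andP[xr rl].
      by exists r; rewrite lte_fin.
    + have /rat_in_itvoo[r] : x < x + 1 by rewrite ltrDl.
      by rewrite in_itv/= => /andP[xr _]; exists r; rewrite ?lte_fin ?ltry.
  - by rewrite ltNge leey.
have r0 : 0 < ratr r :> R by rewrite -lte_fin; exact: le_lt_trans Xr.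
move: Xr; apply/negP; rewrite -leNgt; apply: ereal_sup_ubound.
exists (pickle r) => //; rewrite /rational_passage pickleK/=.
by rewrite r0 -(lt_inverse_process t rc mono pos r0) rL.
Qed.

Lemma poweR_layer (R : realType) (q : R) (x : \bar R) : 0 < q -> (0 <= x)%E ->
  (x `^ q = \int[lebesgue_measure]_(s in `]0%R, +oo[)
     (if s%:E < x then (q * s `^ (q - 1))%:E else 0))%E.
Proof.
move=> q0 x0.
case: x x0 => [r|_|//].
- rewrite lee_fin le_eqVlt poweR_EFin => /orP[/eqP <-|r0].
    rewrite powR0 ?gt_eqF// integral0_eq// => s.
    by rewrite /= in_itv/= andbT => s0; rewrite lte_fin ltNge ltW.
  rewrite -integral_powRB1//.
  have -> : `]0, r[%classic = `]0, +oo[ `&` [set s | s < r].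
    apply/seteqP; split => s /=; rewrite !in_itv/= andbT.
      by move=> /andP[-> ->].
    by move=> [-> ->].
  rewrite integral_mkcondr; apply: eq_integral => s _.
  rewrite patchE lte_fin; congr (if _ then _ else _).
  by apply/idP/idP; rewrite inE.
- rewrite poweRyr ?gt_eqF//; apply/esym.
  under eq_integral do rewrite ltry.
  apply/eqyP => A A0; pose z := A `^ q^-1.
  have z0 : 0 < z by exact: powR_gt0.
  have -> : A = z `^ q by rewrite /z -powRrM mulVf ?gt_eqF// powRr1// ltW.
  rewrite -integral_powRB1//; apply: ge0_subset_integral => //.
  + apply/measurable_EFinP; apply: measurable_funM => //.
    exact: measurable_powR_in.
  + by move=> s _; rewrite lee_fin mulr_ge0 ?powR_ge0// ltW.
  + by move=> s /=; rewrite !in_itv/= andbT => /andP[].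
Qed.

Lemma gamma_subordinator_paths (d : measure_display) (T : measurableType d) (R : realType)
    (P : probability T R) (a b : R) (H : R -> {RV P >-> R}) :
  0 < a -> 0 < b -> gamma_subordinator a b H ->
  {ae P, forall w, [/\ cadlag (fun u => H u w),
    forall u v, 0 <= u -> u <= v -> H u w <= H v w &
    forall u, 0 < u -> 0 < H u w]}.
Proof.
move=> a0 b0 HH; have [[LH mono] _] := HH.
have pos : {ae P, forall w, forall n : nat, 0 < H n.+1%:R^-1 w}.
  apply: ae_foralln => n; apply: gamma_subordinator_gt0 a0 b0 HH _.
  by rewrite invr_gt0.
move: (levy_cadlag LH) mono pos; apply: filterS3 => w rc mono pos.
split => // u u0.
have [n _ /(_ n (leqnn n))] : \forall n \near \oo, (n.+1%:R)^-1 < u.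
  exact: near_infty_natSinv_lt (PosNum u0).
by move=> nu; apply: lt_le_trans (pos n) _; apply: mono; rewrite ?ltW.
Qed.

Lemma inverse_process_moment (d : measure_display) (T : measurableType d)
    (R : realType) (P : probability T R) (a b : R) (H : R -> {RV P >-> R})
    (q t : R) :
  0 < a -> 0 < b -> gamma_subordinator a b H -> 0 < q -> 0 < t ->
  (\int[P]_w (inverse_process H t w `^ q) =
   (q / a `^ q)%:E * gamma_cdf_moment q (b * t))%E.
Proof.
move=> a0 b0 HH q0 t0.
have good := gamma_subordinator_paths a0 b0 HH.
have mX := measurable_passage H t.
have X0 w := passage_ge0 H t w.
transitivity (\int[P]_w (passage H t w `^ q))%E.
  apply: ge0_ae_eq_integral_measurable.
  - by move=> w; exact: poweR_ge0.
  - by move=> w; exact: poweR_ge0.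
  - apply: (@measurableT_comp _ _ _ _ _ _ (fun x : \bar R => (x `^ q)%E) _
      (passage H t)) => //.
    exact: measurable_poweR.
  - by apply: filterS good => w [rc mono pos]; rewrite inverse_process_passage.
under eq_integral do rewrite (poweR_layer q0 (X0 _)).
pose f (z : T * R) : \bar R :=
  (if (z.2%:E < passage H t z.1)%E then (q * z.2 `^ (q - 1))%:E else 0)%E.
have mD : measurable (`]0, +oo[%classic : set (measurableTypeR R)).
  exact: measurable_itv.
have mf : measurable_fun (setT `*` (`]0, +oo[%classic : set R)) f.
  apply: measurable_funS measurableT (@subsetT _ _) _.
  apply: measurable_fun_ifT.
  - apply: measurable_fun_lte.
      by apply/measurable_EFinP; exact: measurable_snd.
    apply: (@measurableT_comp _ _ _ _ _ _ (passage H t) _ fst) => //.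
  - apply/measurable_EFinP; apply: measurable_funM => //.
    apply: (@measurableT_comp _ _ _ _ _ _ (fun x : R => x `^ (q - 1)) _ snd).
      exact: measurable_powR.
    exact: measurable_snd.
  - exact: measurable_cst.
have f0 z : (setT `*` `]0, +oo[%classic) z -> (0 <= f z)%E.
  move=> [_]; rewrite /= in_itv/= andbT => z0; rewrite /f; case: ifP => // _.
  by rewrite lee_fin mulr_ge0 ?powR_ge0// ltW.
rewrite (tonelli_on P lebesgue_measure measurableT mD mf f0).
have Pf (s : R) : 0 < s ->
    (\int[P]_w f (w, s) = (q * s `^ (q - 1))%:E * gamma_cdf (a * s) (b * t))%E.
  move=> s0.
  rewrite -(gamma_subordinator_law a0 b0 HH s0 t0).
  pose c := (q * s `^ (q - 1))%:E.
  have c0 : (0 <= c)%E by rewrite lee_fin mulr_ge0 ?powR_ge0// ltW.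
  pose A := [set w | H s w < t].
  have mA : measurable A by exact: measurable_lt_RV.
  transitivity (\int[P]_w (cst c \_ A) w)%E.
    apply: ge0_ae_eq_integral_measurable.
    - by move=> w; rewrite /f; case: ifP.
    - by move=> w; apply: erestrict_ge0.
    - by apply: (iffLR (measurable_restrictT _ _)) => //; exact: measurable_cst.
    - apply: filterS good => w [rc mono pos].
      rewrite /f patchE/= -(inverse_process_passage t rc mono pos).
      rewrite (lt_inverse_process t rc mono pos s0); congr (if _ then _ else _).
      by apply/idP/idP; rewrite inE.
  by rewrite -integral_mkcond integral_cst.
transitivity (\int[lebesgue_measure]_(s in `]0%R, +oo[)
   (q%:E * ((s `^ (q - 1))%:E * gamma_cdf (a * s) (b * t))))%E.
  apply: eq_integral => s; rewrite inE/= in_itv/= andbT => s0.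
  by rewrite (Pf _ s0) [RHS]muleA -EFinM.
have G0 (v : R) : `]0, +oo[%classic v ->
    (0 <= (v `^ (q - 1))%:E * gamma_cdf (a * v) (b * t))%E.
  rewrite /= in_itv/= andbT => v0.
  apply: mule_ge0; first by rewrite lee_fin powR_ge0.
  by apply: gamma_cdf_ge0; rewrite mulr_gt0.
have q0' : (0 <= q%:E)%E by rewrite lee_fin ltW.
rewrite (ge0_integralZl lebesgue_measure mD
  (measurable_gamma_cdf_scaled q (b * t) a0) G0 q0').
rewrite (gamma_cdf_moment_scale (b * t) q0 a0) muleA -EFinM.
by rewrite divfK// gt_eqF// powR_gt0.
Qed.

Theorem theorem8 (d : measure_display) (T : measurableType d) (R : realType)
    (P : probability T R) (a b : R) (ha : 0 < a) (hb : 0 < b)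
    (H : R -> {RV P >-> R}) (hH : gamma_subordinator a b H)
    (q : R) (hq : 1 <= q) :
  let L := inverse_process H in
  let moment := fun t : R => (\int[P]_w (L t w `^ q))%E in
  (forall t : R, 0 < t ->
     (moment t =
        (Gamma (q + 1) / a `^ q)%:E *
        \sum_(0 <= n <oo) ((expR (- (b * t)))%:E * mu (b * t) (q - 1) n%:R)
      /\
      (Gamma (q + 1) / a `^ q)%:E *
        \sum_(0 <= n <oo) ((expR (- (b * t)))%:E * mu (b * t) (q - 1) n%:R) =
      (b * Gamma (q + 1) / a `^ q)%:E *
        \int[lebesgue_measure]_(s in `]0%R, t[)
          ((expR (- (b * s)))%:E * mu (b * s) (q - 1) (- 1)))%E)
  /\
  sim_pinfty moment (fun t : R => (b * t / a) `^ q).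
Proof.
move=> L moment.
have q0 : 0 < q by exact: lt_le_trans hq.
have aq0 : 0 < a `^ q by exact: powR_gt0.
have momentE t : 0 < t ->
    moment t = ((q / a `^ q)%:E * gamma_cdf_moment q (b * t))%E.
  exact: inverse_process_moment ha hb hH q0.
have G0 := Gamma_gt0 q0.
split=> [t t0|].
  rewrite (momentE _ t0) (nneseries_mu q0 (mulr_gt0 hb t0)).
  rewrite (integral_mu q0 hb t0) (GammaS q0).
  move: (gamma_cdf_moment q (b * t)) (Gamma q) G0 => M g g0.
  rewrite ![((_ / a `^ q)%:E * (_%:E * M))%E]muleA -!EFinM.
  by split; congr (_%:E * _)%E; field; rewrite !gt_eqF.
exists 1 => //.
have bz : b * z @[z --> +oo] --> +oo.
  apply/cvgryPge => A; apply: filterS (nbhs_pinfty_ge (num_real (A / b))) => z.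
  by rewrite ler_pdivrMr// mulrC.
have := cvg_comp _ _ bz (cvg_gamma_cdf_moment q0).
move=> /(cvgeZl (y := q%:E) isT).
rewrite -EFinM divff ?gt_eqF//; apply: cvg_trans; apply: near_eq_cvg.
near=> z; have z0 : 0 < z by near: z; exact: nbhs_pinfty_gt.
have bz0 : 0 < b * z by exact: mulr_gt0.
have -> : (b * z / a) `^ q = (b * z) `^ q / a `^ q.
  rewrite (powRM _ (ltW bz0)) ?invr_ge0 ?(ltW ha)//.
  by rewrite -(powR_inv1 (ltW ha)) -powRrM mulN1r powRN.
rewrite /= (momentE _ z0) [RHS]muleAC [LHS]muleCA -!EFinM [LHS]muleC.
have := powR_gt0 q bz0; move: ((b * z) `^ q) => c c0.
by congr (_%:E * _)%E; field; rewrite !gt_eqF.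
Unshelve. all: by end_near. Qed.
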